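(* Let $\mathfrak{g}$ be a finite dimensional simple complex Lie algebra, let $\alpha$ be a simple root and $k$ its coefficient in the decomposition of the maximal root $\alpha_{\max}$ as a combination of simple roots. Let $a(u)=\frac{1}{1-u}$. (i) If $k=1$, there exists a one-to-one correspondence between Lagrangian subalgebras $W$ of $\mathfrak{g}((u))\oplus\mathfrak{g}$, with respect to $Q_{a(u)}$, which are transversal to $\mathfrak{g}[[u]]$ and satisfy $W\subseteq (\mathbb{O}_{\alpha}\cap\mathfrak{g}[u,u^{-1}])\oplus\mathfrak{g}$, and Lagrangian subalgebras in $\mathfrak{g}\oplus\mathfrak{g}$, with respect to $\bar{Q}$, transversal to $\Delta_{\alpha}$. (ii) If $k>1$, there are no Lagrangian subalgebras $W$ of $\mathfrak{g}((u))\oplus\mathfrak{g}$, with respect to $Q_{a(u)}$, which are transversal to $\mathfrak{g}[[u]]$ and satisfy $W\subseteq (\mathbb{O}_{\alpha}\cap\mathfrak{g}[u,u^{-1}])\oplus\mathfrak{g}$.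
   Context: $\mathfrak{g}$ has a fixed Cartan subalgebra $\mathfrak{h}$, root system $R$, set of simple roots $\Gamma=\{\alpha_i\}$, root spaces $\mathfrak{g}_\beta$, and maximal root $\alpha_{\max}=\sum_j k_j\alpha_j$. A root ''contains'' $\alpha$ if its coefficient at $\alpha$ in the expansion in simple roots is non-zero. $K$ denotes the Killing form of $\mathfrak{g}$, and also its $\mathbb{C}((u))$-bilinear extension to $\mathfrak{g}((u))$. The form on $\mathfrak{g}((u))\oplus\mathfrak{g}$: $Q_{a(u)}(f_1+x_1,f_2+x_2)=\mathrm{Res}_{u=0}(u^{-1}a(u)K(f_1(u),f_2(u)))-K(x_1,x_2)$ for $f_1,f_2\in\mathfrak{g}((u))$, $x_1,x_2\in\mathfrak{g}$, where $a(u)$ is regarded as a Taylor series at $u=0$. The algebra $\mathfrak{g}[[u]]$ is embedded in $\mathfrak{g}((u))\oplus\mathfrak{g}$ by $f(u)\mapsto (f(u),f(0))$. The maximal order $\mathbb{O}_\alpha$: let $\mathfrak{h}(\mathbb{R})=\{h\in\mathfrak{h}:\beta(h)\in\mathbb{R}\ \forall\beta\in R\}$, and let $v$ be the valuation on $\mathbb{C}((u^{-1}))$ with $v(\sum_{m\ge n}a_mu^{-m})=n$ when $a_n\ne0$ (and $v(0)=+\infty$). For $h\in\mathfrak{h}(\mathbb{R})$ and $\beta\in R$ put $M_\beta(h)=\{f\in\mathbb{C}((u^{-1})):v(f)\ge\beta(h)\}$ and $\mathbb{O}_h=\mathfrak{h}[[u^{-1}]]\oplus\bigoplus_{\beta\in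 R}M_\beta(h)\otimes\mathfrak{g}_\beta$. For $\alpha=\alpha_j$ set $\mathbb{O}_\alpha=\mathbb{O}_{h_j}$, where $h_j\in\mathfrak{h}(\mathbb{R})$ is defined by $\alpha_i(h_j)=\delta_{ij}/k_j$ for all $i$. The intersection $\mathbb{O}_\alpha\cap\mathfrak{g}[u,u^{-1}]$ is taken in $\mathfrak{g}((u^{-1}))$, and $\mathfrak{g}[u,u^{-1}]$ is also viewed inside $\mathfrak{g}((u))$. The form on $\mathfrak{g}\oplus\mathfrak{g}$: $\bar{Q}((x_1,y_1),(x_2,y_2))=K(x_1,x_2)-K(y_1,y_2)$. $P_\alpha^-$ is the standard parabolic subalgebra of $\mathfrak{g}$ spanned by $\mathfrak{h}$, the root spaces of all negative roots and the root spaces of all positive roots which do not contain $\alpha$. Its reductive part is the subalgebra spanned by $\mathfrak{h}$ and the root spaces of all roots not containing $\alpha$; the reductive part of an element of $P_\alpha^-$ is its component there along the decomposition of $P_\alpha^-$ as reductive part plus the sum of the root spaces of negative roots containing $\alpha$. $\Delta_\alpha$ is the set of pairs $(x,y)\in P_\alpha^-\times P_\alpha^-$ having the same reductive parts. A Lie subalgebra $W$ is Lagrangian with respect to a nondegenerate invariant bilinear form if $W=W^\perp$. Two subspaces are transversal if the ambient space is their direct sum. *)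

(* Defs.v *)
From HB Require Import structures.
From mathcomp Require Import all_boot all_order all_algebra.
From mathcomp Require Import boolp classical_sets functions cardinality fsbigop.
From mathcomp Require Import reals.
From mathcomp Require Import complex.

Set Implicit Arguments.
Unset Strict Implicit.
Unset Printing Implicit Defensive.

Import Order.TTheory GRing.Theory Num.Theory.
Local Open Scope classical_set_scope.
Local Open Scope ring_scope.

Section LieAlgebra.
Variables (K : fieldType) (g : vectType K) (br : {bilinear g -> g -> g}).

Definition lie_bracket : Prop :=
  (forall x, br x x = 0) /\
  (forall x y z, br x (br y z) + br y (br z x) + br z (br x y) = 0).

Definition lie_ideal (I : {vspace g}) : Prop :=
  forall x y, y \in I -> br x y \in I.

Definition simple_lie_algebra : Prop :=
  [/\ lie_bracket,
      exists x y, br x y != 0 &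
      forall I : {vspace g}, lie_ideal I -> I = 0%VS \/ I = fullv].

Definition ad (x : g) : 'End(g) := linfun (br x).

Definition killing (x y : g) : K :=
  \tr (passmx.mxof (vbasis {:g}) (vbasis {:g}) (ad x \o ad y)%VF).

Definition bracketv (U V : {vspace g}) : {vspace g} :=
  <<[seq br x y | x <- vbasis U, y <- vbasis V]>>%VS.

Definition cartan_subalgebra (H : {vspace g}) : Prop :=
  [/\ (bracketv H H <= H)%VS,
      exists n, iter n (bracketv H) H = 0%VS &
      forall x, (forall h, h \in H -> br x h \in H) -> x \in H].

End LieAlgebra.

Section Roots.
Variables (K : numFieldType) (g : vectType K) (br : {bilinear g -> g -> g}).
Variable H : {vspace g}.

Definition dual : vectType K := 'Hom(subvs_of H, K^o).

Definition root_space (beta : dual) : {vspace g} :=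
  (\bigcap_(i < \dim {: subvs_of H})
     let h := (vbasis {: subvs_of H})`_i in
     lker (ad br (vsval h) - (beta h : K) *: \1%VF))%VS.

Definition roots : set dual :=
  [set beta | beta != 0 /\ root_space beta != 0%VS].

Definition root_space_sum (A : set dual) : {vspace g} :=
  \big[@addv K g/0%VS]_(beta \in A) root_space beta.

Variables (l : nat) (Gamma : l.-tuple dual).

Definition nneg_comb (beta : dual) : Prop :=
  exists n : 'I_l -> nat, beta = \sum_(i < l) Gamma`_i *+ n i.

Definition simple_roots : Prop :=
  [/\ free Gamma,
      forall i : 'I_l, roots Gamma`_i &
      forall beta, roots beta -> nneg_comb beta \/ nneg_comb (- beta)].

Definition positive_roots : set dual := [set beta | roots beta /\ nneg_comb beta].
Definition negative_roots : set dual :=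
  [set beta | roots beta /\ nneg_comb (- beta)].

(* greatest root for the partial order defined by the simple roots *)
Definition maximal_root (theta : dual) : Prop :=
  roots theta /\ forall beta, roots beta -> nneg_comb (theta - beta).

(* the roots that contain the simple root of index j *)
Definition containing (j : 'I_l) : set dual :=
  [set beta | coord Gamma j beta != 0].

Definition parabolic (j : 'I_l) : {vspace g} :=
  (H + root_space_sum negative_roots
     + root_space_sum (positive_roots `\` containing j))%VS.

Definition reductive_part (j : 'I_l) : {vspace g} :=
  (H + root_space_sum (roots `\` containing j))%VS.

Definition nilpotent_part (j : 'I_l) : {vspace g} :=
  root_space_sum (negative_roots `&` containing j).

Definition Delta (j : 'I_l) : set (g * g) :=
  [set p | [/\ p.1 \in parabolic j, p.2 \in parabolic j &
     daddv_pi (reductive_part j) (nilpotent_part j) p.1 =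
     daddv_pi (reductive_part j) (nilpotent_part j) p.2]].

Definition real_cartan : set (subvs_of H) :=
  [set h | forall beta : dual, roots beta -> (beta h : K) \is Num.real].

Definition scaled_coweight (k : 'I_l -> nat) (j : 'I_l) (h : subvs_of H) : Prop :=
  real_cartan h /\
  forall i : 'I_l, ((Gamma`_i : dual) h : K) = (i == j)%:R / (k j)%:R.

End Roots.

(* A formal Laurent series is represented by its coefficient function: f m is
   the coefficient of t^m, where t = u for g((u)) and t = u^-1 for g((u^-1)). *)
Section Laurent.

Definition laurent (V : zmodType) : set (int -> V) :=
  [set f | exists N : int, forall m, m < N -> f m = 0].

Definition power_series (V : zmodType) : set (int -> V) :=
  [set f | forall m, m < 0 -> f m = 0].

(* The extension of a bilinear map B to Laurent series.  For Laurent series the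
   sum has finite support. *)
Definition convol (U V W : zmodType) (B : U -> V -> W)
    (f : int -> U) (f' : int -> V) : int -> W :=
  fun m => \sum_(i \in [set: int]) B (f i) (f' (m - i)).

Definition monomial (K : pzRingType) (n : int) : int -> K :=
  fun m => (m == n)%:R.

Definition residue (V : zmodType) (f : int -> V) : V := f (-1).

(* the Taylor series at 0 of 1 / (1 - u), see geometricP *)
Definition geometric (K : pzRingType) : int -> K :=
  fun m => if 0 <= m then 1 else 0.

Definition has_valuation (V : zmodType) (f : int -> V) (n : int) : Prop :=
  f n != 0 /\ forall m, m < n -> f m = 0.

(* the image of M (x) U in the space of g-valued series *)
Definition tensor (K : fieldType) (g : vectType K) (M : set (int -> K))
    (U : {vspace g}) : set (int -> g) :=
  [set f | exists (n : nat) (phi : 'I_n -> int -> K) (x : 'I_n -> g),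
    (forall i, M (phi i) /\ x i \in U) /\
    f = fun m => \sum_(i < n) phi i m *: x i].

End Laurent.

Section Orders.
Variables (K : numFieldType) (g : vectType K) (br : {bilinear g -> g -> g}).
Variable H : {vspace g}.

(* Subsets of K((u^-1)) and g((u^-1)).  The zero series has no valuation n, in
   accordance with v(0) = +oo. *)
Definition val_ge (r : K) : set (int -> K) :=
  [set f | laurent f /\ forall n, has_valuation f n -> r <= n%:~R].

Definition order_at (h : subvs_of H) : set (int -> g) :=
  [set f | exists (f0 : int -> g) (fr : dual H -> int -> g),
    [/\ power_series f0, forall m, f0 m \in H,
        forall beta, roots br beta ->
          tensor (val_ge (beta h)) (root_space br beta) (fr beta) &
        f = fun m => f0 m + \sum_(beta \in roots br (H := H)) fr beta m]].

(* The intersection of order_at h with g[u, u^-1], seen in g((u)).  As order_at h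
   consists of Laurent series in u^-1, these f have finite support. *)
Definition order_polynomials (h : subvs_of H) : set (int -> g) :=
  [set f | laurent f /\ order_at h (fun m => f (- m))].

End Orders.

(* Subspaces W of an ambient subspace A, itself given as a subset of a module. *)
Section Lagrangian.
Variables (K : fieldType) (V : lmodType K) (A : set V).

Definition lie_subalgebra (br : V -> V -> V) (W : set V) : Prop :=
  [/\ W `<=` A, W 0,
      forall a x y, W x -> W y -> W (a *: x + y) &
      forall x y, W x -> W y -> W (br x y)].

Definition orthogonal_of (Q : V -> V -> K) (W : set V) : set V :=
  [set x | A x /\ forall y, W y -> Q x y = 0].

Definition lagrangian (br : V -> V -> V) (Q : V -> V -> K) (W : set V) : Prop :=
  lie_subalgebra br W /\ W = orthogonal_of Q W.

Definition transversal_subspaces (W D : set V) : Prop :=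
  A = [set x + y | x in W & y in D] /\ W `&` D = [set 0].

End Lagrangian.

Section Doubles.
Variables (K : fieldType) (g : vectType K) (br : {bilinear g -> g -> g}).

Definition loop_double : set ((int -> g) * g) := [set p | laurent p.1].

Definition loop_double_bracket (p q : (int -> g) * g) : (int -> g) * g :=
  (convol br p.1 q.1, br p.2 q.2).

Definition loop_double_form (a : int -> K) (p q : (int -> g) * g) : K :=
  residue (convol *%R (convol *%R (@monomial K (-1)) a)
                      (convol (killing br) p.1 q.1))
  - killing br p.2 q.2.

Definition current_algebra : set ((int -> g) * g) :=
  [set p | exists2 f, power_series f & p = (f, f 0)].

Definition double_bracket (p q : g * g) : g * g := (br p.1 q.1, br p.2 q.2).

Definition double_form (p q : g * g) : K :=
  killing br p.1 q.1 - killing br p.2 q.2.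

End Doubles.

Arguments loop_double {K} g.
Arguments current_algebra {K} g.

Section Checks.

Lemma geometricP (K : comPzRingType) :
  convol *%R (fun m => @monomial K 0 m - @monomial K 1 m) (geometric K)
  = @monomial K 0.
Proof.
apply/funext => m; rewrite /convol.
rewrite -(@fsbig_widen _ _ _ _ [set` [:: 0; 1 : int]])//; last first.
  move=> i [_] /=; rewrite !inE => /negP; rewrite negb_or /monomial.
  by move=> /andP[/negPf -> /negPf ->]; rewrite subrr mul0r.
rewrite -fsbig_seq// !big_cons big_nil /monomial /geometric /= !subr0 sub0r.
rewrite addr0 mul1r mulN1r subr_ge0; case: m => [[|m]|m] //=.
- by rewrite subr0.
- by rewrite subrr.
by rewrite subrr.
Qed.

Lemma mem_root_space (K : numFieldType) (g : vectType K)
    (br : {bilinear g -> g -> g}) (H : {vspace g}) (beta : dual H) (x : g) :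
  x \in root_space br beta <->
  forall h : subvs_of H, br (vsval h) x = (beta h : K) *: x.
Proof.
have evE (h : subvs_of H) :
    (ad br (vsval h) - (beta h : K) *: \1%VF) x
    = br (vsval h) x - (beta h : K) *: x.
  by rewrite !lfun_simp.
split=> [xB h|xB]; last first.
  rewrite memvE; apply/subv_bigcapP => i _; rewrite -memvE memv_ker evE.
  by rewrite xB subrr.
have xE (i : nat) : (i < \dim {: subvs_of H})%N -> br (vsval (vbasis {: subvs_of H})`_i) x
    = (beta (vbasis {: subvs_of H})`_i : K) *: x.
  move=> ltid; move: xB; rewrite memvE => /subv_bigcapP/(_ (Ordinal ltid) isT).
  by rewrite -memvE memv_ker evE subr_eq0 => /eqP.
rewrite (coord_vbasis (memvf h)) !linear_sum linear_sumlz scaler_suml.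
apply: eq_bigr => i _; rewrite !linearZ /= linearZl_LR xE //=.
by rewrite scalerA.
Qed.

End Checks.

(* Main.v *)
From HB Require Import structures.
From mathcomp Require Import all_boot all_order all_algebra.
From mathcomp Require Import boolp classical_sets functions cardinality fsbigop.
From mathcomp Require Import reals complex zify.
Require Import Defs.

Set Implicit Arguments.
Unset Strict Implicit.
Unset Printing Implicit Defensive.

Import Order.TTheory GRing.Theory Num.Theory.
Local Open Scope classical_set_scope.
Local Open Scope ring_scope.

(** The order attached to the simple root [alpha_j] is graded by the level of a
    root, that is its coefficient at [alpha_j]: a vector of level [m] may occur as
    a coefficient of [u^n] exactly when [m <= - n * k j], and [H] has level 0.

    Suppose [k j = 1].  Levels then lie in {-1, 0, 1}, the order is [g[u^-1]]
    conjugated by a coweight, and the form takes two elements of the order to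
    [kf (f(1)) (q(1)) - kf x y], since the product of [f] and [q] is a polynomial
    in [u^-1] whose coefficients up to degree 0 are summed
    ([loop_double_form_eval1]).  The kernel of [(f, x) |-> (f(1), x)] on the order
    is therefore orthogonal to the order, so every [W] contains it; conversely
    whatever is orthogonal to the kernel lies in the order ([filtered_perp]).
    Hence the [W] correspond to the Lagrangian subalgebras of [g + g].  The
    power series in the order are the [y + u z] with [y] in the parabolic and [z]
    in its nilradical; they evaluate bijectively onto [Delta], so that
    transversality matches on both sides ([evaluate_bij]).

    Suppose [k j > 1] and let [y] be a vector of level -1.  Then [((1 - u) y, 0)]
    is orthogonal to the order, hence in [W], but [u y] is not in the order
    ([no_loop_lagrangian]).

    Both arguments need a nondegenerate Killing form and [g] spanned by [H] and
    the root spaces.  Simplicity makes the form nondegenerate or zero, and for the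
    zero form the only Lagrangian is the whole space, which meets [g[[u]]] and
    [Delta] ([zero_form_loop], [zero_form_double]).  The root decomposition is
    drawn from the existence of a Lagrangian on either side; if there is none,
    both sets are empty and in bijection.  On the loop side it is immediate, because all of [g] occurs as
    coefficients of elements of the order ([loop_decomposition]).  On the side of
    [g + g], a Lagrangian complement of [Delta] forces the parabolic and its
    nilradical to be orthogonals of each other ([parabolic_perp]), so the quotient
    by the parabolic is dual to the nilradical and has weights opposite to it;
    these weight vectors lift to [g] because [ad hj] separates them from the
    parabolic ([dual_root_vector], [double_decomposition]). *)

(** * Sums over the integers *)
Section IntegerSums.
Variable V : zmodType.
Implicit Types (F G : int -> V) (b c : nat).

Definition window b : seq int := [seq i%:Z - b%:Z | i <- iota 0 (b + b).+1].

Lemma mem_window b (i : int) : (i \in window b) = (`|i| <= b%:Z).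
Proof.
apply/mapP/idP => [[n]|le_ib].
  by rewrite mem_iota => /andP[_ ltn] ->; lia.
by exists (absz (i + b%:Z)); rewrite ?mem_iota; lia.
Qed.

Lemma window_uniq b : uniq (window b).
Proof. by rewrite map_inj_uniq ?iota_uniq// => i k /=; lia. Qed.

Lemma fsum_window b F : (forall i, b%:Z < `|i| -> F i = 0) ->
  \sum_(i \in [set: int]) F i = \sum_(i <- window b) F i.
Proof.
move=> F0; rewrite (fsbigE (window b)) ?window_uniq//; last first.
  by move=> i _; rewrite mem_window -ltNge; apply: F0.
by apply: eq_bigl => i; rewrite in_setT.
Qed.

Lemma fsum_finsuppD b F G :
    (forall i, b%:Z < `|i| -> F i = 0) -> (forall i, b%:Z < `|i| -> G i = 0) ->
  \sum_(i \in [set: int]) (F i + G i) =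
  \sum_(i \in [set: int]) F i + \sum_(i \in [set: int]) G i.
Proof.
move=> F0 G0; rewrite !(@fsum_window b)// ?big_split//.
by move=> i bi; rewrite F0// G0// addr0.
Qed.

Lemma fsum_single (n : int) F : (forall i, i != n -> F i = 0) ->
  \sum_(i \in [set: int]) F i = F n.
Proof.
move=> F0; rewrite (fsbigE [:: n])//; last first.
  by move=> i _; rewrite inE => /F0.
by rewrite big_mkcond big_seq1 in_setT.
Qed.

Lemma laurent_bound (f : int -> V) : laurent f ->
  exists b : nat, forall m : int, m < - b%:Z -> f m = 0.
Proof. by case=> N f0; exists (absz N) => m ltm; apply: f0; lia. Qed.

End IntegerSums.

(** * The Killing form *)
Section KillingForm.
Variables (K : fieldType) (g : vectType K) (br : {bilinear g -> g -> g}).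
Hypothesis br_lie : lie_bracket br.
Implicit Types (x y z : g) (a : K).

Local Notation kf := (killing br).

Lemma bracketC x y : br x y = - br y x.
Proof.
case: br_lie => alt _; have := alt (x + y).
rewrite linearDl !linearDr !alt add0r addr0 => /eqP.
by rewrite addr_eq0 => /eqP.
Qed.

Lemma jacobi x y z : br x (br y z) = br (br x y) z + br y (br x z).
Proof.
case: br_lie => _ /(_ x y z)/eqP; rewrite -addrA addr_eq0 => /eqP ->.
by rewrite opprD addrC [br z (br x y)]bracketC opprK [br z x]bracketC linearNr opprK.
Qed.

Lemma adE x y : ad br x y = br x y.
Proof. by rewrite lfunE. Qed.

Let e := vbasis {:g}.
Let mx x := passmx.mxof e e (ad br x).

Let e_basis : basis_of fullv e. Proof. exact: vbasisP. Qed.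

Let e_free (c : 'I_(\dim {:g}) -> K) :
  \sum_(i < \dim {:g}) c i *: e`_i = 0 -> forall i, c i = 0.
Proof. by have /freeP := basis_free e_basis; apply. Qed.

Let mxP a x y : mx (a *: x + y) = a *: mx x + mx y.
Proof.
rewrite /mx -passmx.mxof_linear; congr (passmx.mxof _ _ _).
by apply/lfunP => z; rewrite !lfun_simp/= ?adE linearPl.
Qed.

Let mxD x y : mx (x + y) = mx x + mx y.
Proof. by rewrite -[x in LHS]scale1r mxP scale1r. Qed.

Let mxZ a x : mx (a *: x) = a *: mx x.
Proof.
have mx0 : mx 0 = 0 by apply: (addIr (mx 0)); rewrite -mxD !add0r.
by rewrite -[in LHS](addr0 (a *: x)) mxP mx0 addr0.
Qed.

Let mxbr x y : mx (br x y) = mx y *m mx x - mx x *m mx y.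
Proof.
rewrite /mx -!(passmx.mxof_comp _ _ e_basis) addrC -scaleN1r.
rewrite -passmx.mxof_linear; congr (passmx.mxof _ _ _).
apply/lfunP => z; rewrite !lfun_simp/= ?adE.
by rewrite [br x (br y z)]jacobi scaleN1r addrC addrK.
Qed.

Let kfE x y : kf x y = \tr (mx y *m mx x).
Proof. by rewrite /killing (passmx.mxof_comp _ _ e_basis). Qed.

Lemma killingC x y : kf x y = kf y x.
Proof. by rewrite !kfE mxtrace_mulC. Qed.

Lemma killingDl x y z : kf (x + y) z = kf x z + kf y z.
Proof. by rewrite !kfE mxD mulmxDr mxtraceD. Qed.

Lemma killingZl a x z : kf (a *: x) z = a * kf x z.
Proof. by rewrite !kfE mxZ -scalemxAr mxtraceZ. Qed.

Lemma killing_invariant x y z : kf (br x y) z = kf x (br y z).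
Proof.
rewrite !kfE !mxbr mulmxBl mulmxBr !linearB/= mulmxA; congr (_ - _).
by rewrite mxtrace_mulC -!mulmxA mxtrace_mulC !mulmxA.
Qed.

Lemma killingDr x y z : kf z (x + y) = kf z x + kf z y.
Proof. by rewrite killingC killingDl !(killingC z). Qed.

Lemma killingZr a x z : kf z (a *: x) = a * kf z x.
Proof. by rewrite killingC killingZl killingC. Qed.

Lemma killing0l z : kf 0 z = 0.
Proof. by rewrite -(scale0r 0) killingZl mul0r. Qed.

Lemma killing0r z : kf z 0 = 0.
Proof. by rewrite killingC killing0l. Qed.

Lemma killingNl x z : kf (- x) z = - kf x z.
Proof. by rewrite -scaleN1r killingZl mulN1r. Qed.

Lemma killingNr x z : kf z (- x) = - kf z x.
Proof. by rewrite killingC killingNl killingC. Qed.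

Lemma killingBl x y z : kf (x - y) z = kf x z - kf y z.
Proof. by rewrite killingDl killingNl. Qed.

Lemma killingBr x y z : kf z (x - y) = kf z x - kf z y.
Proof. by rewrite killingDr killingNr. Qed.

Lemma killing_suml I (r : seq I) (P : pred I) (F : I -> g) z :
  kf (\sum_(i <- r | P i) F i) z = \sum_(i <- r | P i) kf (F i) z.
Proof.
by apply: (big_morph (kf^~ z)) => [x y|]; rewrite ?killingDl ?killing0l.
Qed.

Lemma killing_sumr I (r : seq I) (P : pred I) (F : I -> g) z :
  kf z (\sum_(i <- r | P i) F i) = \sum_(i <- r | P i) kf z (F i).
Proof. by rewrite killingC killing_suml; apply: eq_bigr => i _; rewrite killingC. Qed.

Lemma killing_ad x y z : kf (br x y) z = - kf y (br x z).
Proof. by rewrite bracketC killingNl killing_invariant. Qed.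

Definition killing_nondeg : Prop := forall x, (forall y, kf x y = 0) -> x = 0.

(** The functional [kf x], turned into a vector through the basis [e] so that the
    radical becomes the kernel of an endomorphism. *)
Definition killing_vector x : g := \sum_(i < \dim {:g}) kf x e`_i *: e`_i.

Let killing_vector_linear : linear killing_vector.
Proof.
move=> a x y; rewrite /killing_vector scaler_sumr -big_split/=.
by apply: eq_bigr => i _; rewrite killingDl killingZl scalerDl scalerA.
Qed.

HB.instance Definition _ := GRing.isLinear.Build K g g *:%R killing_vector
  killing_vector_linear.

Lemma killing_vector_eq0 x : killing_vector x = 0 -> forall y, kf x y = 0.
Proof.
move=> /e_free kx0 y.
rewrite (coord_vbasis (memvf y)) killing_sumr big1// => i _.
by rewrite killingZr kx0 mulr0.
Qed.

(** Invariance makes the radical of the form an ideal, hence trivial or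
    everything. *)
Lemma simple_killing : simple_lie_algebra br ->
  killing_nondeg \/ forall x y, kf x y = 0.
Proof.
case=> _ _ ideals.
have radP x : reflect (forall y, kf x y = 0) (x \in lker (linfun killing_vector)).
  rewrite memv_ker lfunE/=; apply: (iffP eqP) => [|kx0].
    exact: killing_vector_eq0.
  by rewrite /killing_vector big1// => i _; rewrite kx0 scale0r.
have ideal : lie_ideal br (lker (linfun killing_vector)).
  move=> x y /radP ky0; apply/radP => z.
  by rewrite killing_ad ky0 oppr0.
case: (ideals _ ideal) => radE.
  left=> x /radP; rewrite radE memv0 => /eqP //.
by right=> x; apply/radP; rewrite radE memvf.
Qed.

(** If [x] is not in [U], some linear functional vanishes on [U] and not at [x];
    nondegeneracy represents it as pairing with a vector. *)
Lemma killing_biorthogonal (U : {vspace g}) x : killing_nondeg ->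
  (forall y, (forall u, u \in U -> kf y u = 0) -> kf y x = 0) -> x \in U.
Proof.
move=> nondeg Ux; apply/contraT => xNU.
pose w := x - projv U x.
have w0 : w != 0.
  by apply: contraNneq xNU => /eqP; rewrite subr_eq0 => /eqP ->; apply: memv_proj.
have [i wi] : exists i, coord e i w != 0.
  apply/existsP; apply: contraNT w0; rewrite negb_exists => /forallP w0.
  rewrite (coord_vbasis (memvf w)) big1// => i _.
  by have := w0 i; rewrite negbK => /eqP ->; rewrite scale0r.
pose phi y := coord e i (y - projv U y).
have surj : limg (linfun killing_vector) = fullv.
  apply/eqP; rewrite -dimv_leqif_eq ?subvf// limg_dim_eq//.
  apply/eqP; rewrite -subv0; apply/subvP => y.
  rewrite memv_cap memv_ker lfunE/= => /andP[_ /eqP/killing_vector_eq0].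
  by move/nondeg ->; apply: mem0v.
have phi_lin a y z : phi (a *: y + z) = a * phi y + phi z.
  rewrite /phi linearP opprD addrACA -scalerBr linearD linearZ/=.
  by [].
have /memv_imgP[y _ yE] : \sum_(n < \dim {:g}) phi e`_n *: e`_n
    \in limg (linfun killing_vector) by rewrite surj memvf.
have {}yE n : kf y e`_(n : 'I_(\dim {:g})) = phi e`_n.
  apply/eqP; rewrite -subr_eq0; apply/eqP.
  apply: (e_free (c := fun n => kf y e`_n - phi e`_n)).
  rewrite (eq_bigr (fun n : 'I_(\dim {:g}) => kf y e`_n *: e`_n - phi e`_n *: e`_n)).
    by rewrite big_split/= sumrN yE lfunE /= subrr.
  by move=> ? _; rewrite scalerBl.
have yphi z : kf y z = phi z.
  rewrite (coord_vbasis (memvf z)) killing_sumr.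
  rewrite (big_morph phi (id1 := 0) (op1 := +%R)).
  - apply: eq_bigr => n _; rewrite killingZr yE -[in RHS](addr0 (_ *: _)) phi_lin.
    by rewrite /phi linear0 subr0 linear0 addr0.
  - by move=> u v; rewrite -[u in LHS]scale1r phi_lin mul1r.
  - by rewrite /phi linear0 subr0 linear0.
case/eqP: wi; rewrite -[LHS]/(phi x) -yphi; apply: Ux => u uU.
by rewrite yphi /phi projv_id// subrr linear0.
Qed.

End KillingForm.

(** * Laurent series and the form on the loop double *)
Section Series.
Variable V : zmodType.
Implicit Types (f q : int -> V).

Definition eval1 f : V := \sum_(i \in [set: int]) f i.

Definition partial_sum f (m : int) : V :=
  \sum_(j \in [set: int]) (if j <= m then f j else 0).

Definition single (n : int) (x : V) : int -> V := fun m => if m == n then x else 0.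

Lemma single_laurent n x : laurent (single n x).
Proof. by exists n => m ltmn; rewrite /single lt_eqF. Qed.

Lemma eval1_single n x : eval1 (single n x) = x.
Proof.
rewrite /eval1 (@fsum_single _ n) /single ?eqxx// => i /negPf ->.
by [].
Qed.

Lemma laurentD f q : laurent f -> laurent q -> laurent (f + q).
Proof.
move=> /laurent_bound[b fb] /laurent_bound[c qc]; exists (- (b + c)%:Z) => m ltm.
by rewrite fctE fb ?qc ?addr0//; lia.
Qed.

Lemma laurentN f : laurent f -> laurent (- f).
Proof. by case=> N fN; exists N => m /fN fm; rewrite fctE fm oppr0. Qed.

Lemma laurentB f q : laurent f -> laurent q -> laurent (f - q).
Proof. by move=> ? /laurentN; apply: laurentD. Qed.

(** These elements [u^n (1 - u) x] serve as test vectors: the factor [1 - u]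
    cancels [a(u)], so each of them reads off a single coefficient. *)
Lemma partial_sum_step n x m :
  partial_sum (single n x - single (n + 1) x) m = if m == n then x else 0.
Proof.
rewrite /partial_sum (@eq_fsbigr _ _ _ _ _
    (fun j => (if j <= m then single n x j else 0) +
              (if j <= m then - single (n + 1) x j else 0))); last first.
  by move=> j _; rewrite !fctE; case: ifP; rewrite ?addr0.
rewrite (@fsum_finsuppD _ (absz n).+1).
- rewrite (@fsum_single _ n) => [|i /negPf ni]; last by rewrite /single ni if_same.
  rewrite (@fsum_single _ (n + 1)) => [|i /negPf ni]; last first.
    by rewrite /single ni oppr0 if_same.
  rewrite /single !eqxx; case: (ltgtP m n) => mn.
  + by rewrite !ifN ?addr0//; lia.
  + by rewrite !ifT ?subrr//; lia.
  + by rewrite ifN ?addr0//; lia.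
- by move=> i ni; rewrite /single; case: ifP => // _; rewrite ifN//; lia.
- by move=> i ni; rewrite /single; case: ifP => // _; rewrite ifN ?oppr0//; lia.
Qed.

End Series.

Section LoopForm.
Variables (K : fieldType) (g : vectType K) (br : {bilinear g -> g -> g}).
Hypothesis br_lie : lie_bracket br.
Implicit Types (f q : int -> g) (x y z : g).

Local Notation kf := (killing br).
Local Notation Q := (loop_double_form br (geometric K)).

Lemma loop_double_formC (p p' : (int -> g) * g) : Q p p' = Q p' p.
Proof.
rewrite /loop_double_form [killing br p.2 _]killingC; congr (residue (convol _ _ _) - _).
apply/funext => m; rewrite /convol (@reindex_fsbigT _ _ _ _ _ (fun i => m - i)); last first.
  by exists (fun i => m - i) => i; rewrite subKr.
by apply: eq_fsbigr => i _; rewrite subKr killingC.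
Qed.

(** Multiplying by [1 / (1 - u)] replaces coefficients by partial sums, so the
    residue pairs the coefficients whose total degree is at most 0; summing over
    the second series first leaves its partial sums. *)
Lemma loop_double_formE f q x y : laurent f -> laurent q ->
  Q (f, x) (q, y) =
  \sum_(i \in [set: int]) kf (f i) (partial_sum q (- i)) - kf x y.
Proof.
move=> /laurent_bound[bf f0] /laurent_bound[bq q0]; rewrite /loop_double_form /=.
congr (_ - _); pose b := (bf + bq)%N; pose w := window (b + b).+1.
have {}f0 m : m < - b%:Z -> f m = 0 by move=> ltm; apply: f0; lia.
have {}q0 m : m < - b%:Z -> q m = 0 by move=> ltm; apply: q0; lia.
have coefE i : convol *%R (@monomial K (-1)) (geometric K) i = if -1 <= i then 1 else 0.
  rewrite /convol (@fsum_single _ (-1)) => [|j /negPf nj]; last first.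
    by rewrite /monomial nj mul0r.
  by rewrite /monomial eqxx mul1r /geometric; congr (if _ then _ else _); lia.
have inner i : -1 <= i -> convol kf f q (-1 - i) = \sum_(n <- w) kf (f n) (q (-1 - i - n)).
  move=> i1; rewrite /convol (@fsum_window _ (b + b).+1)// => n nw.
  have [n0|n0] := ltP n 0; first by rewrite f0 ?killing0l//; lia.
  by rewrite q0 ?killing0r//; lia.
rewrite /residue /convol -/(convol _ _ _).
rewrite (@fsum_window _ (b + b).+1); last first.
  move=> i iw; have := coefE i; rewrite /convol => ->.
  case: ifP => i1; last by rewrite mul0r.
  rewrite mul1r -/(convol _ _ _ _) inner// big1// => n _.
  have [n0|n0] := ltP n (- b%:Z); first by rewrite f0 ?killing0l//; lia.
  by rewrite q0 ?killing0r//; lia.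
rewrite [RHS](@fsum_window _ (b + b).+1); last first.
  move=> i iw; have [n0|n0] := ltP i 0; first by rewrite f0 ?killing0l//; lia.
  rewrite /partial_sum fsbig1 ?killing0r// => j _; case: ifP => // ji.
  by rewrite q0//; lia.
transitivity (\sum_(i <- w) \sum_(n <- w)
    if -1 <= i then kf (f n) (q (-1 - i - n)) else 0).
  apply: eq_bigr => i _; have := coefE i; rewrite /convol => ->.
  case: ifP => i1; last by rewrite mul0r big1.
  by rewrite mul1r -/(convol _ _ _ _) inner.
rewrite exchange_big; apply: eq_bigr => n _ /=.
have [nb|nb] := ltP n (- b%:Z).
  by rewrite f0// killing0l// big1// => i _; rewrite killing0l// if_same.
rewrite /partial_sum (@reindex_fsbigT _ _ _ _ _ (fun i => -1 - n - i)); last first.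
  by exists (fun i => -1 - n - i) => i; rewrite subKr.
rewrite (@fsum_window _ (b + b).+1) ?killing_sumr//; last first.
  move=> i iw; case: ifP => // ji; apply: q0; lia.
apply: eq_bigr => i _; rewrite [-1 - i - n]addrAC.
have -> : (-1 - n - i <= - n) = (-1 <= i) by lia.
by case: ifP; rewrite ?killing0r.
Qed.

Lemma loop_double_form_step f x n z : laurent f ->
  Q (f, x) (single n z - single (n + 1) z, 0) = kf (f (- n)) z.
Proof.
move=> fL; rewrite loop_double_formE//; last first.
  by apply: laurentB; apply: single_laurent.
rewrite killing0r// subr0 (@fsum_single _ (- n)) ?partial_sum_step ?opprK ?eqxx//.
by move=> i ni; rewrite partial_sum_step ifN ?killing0r// eqr_oppLR.
Qed.

End LoopForm.

(** * Evaluation at 1 for a parabolic subalgebra with abelian radical *)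
Section Filtration.
Variables (K : fieldType) (g : vectType K) (P N : {vspace g}).
Implicit Types n : int.

(** The coefficients of [u^n] allowed in the order when the coefficient of the
    simple root in the maximal root is 1: conjugating [g[u^-1]] by the coweight
    shifts the nilradical [N] of [P] up by one degree and its opposite down. *)
Definition filtration n : {vspace g} :=
  if n < 0 then fullv else if n == 0 then P else if n == 1 then N else 0%VS.

Local Notation F := filtration.

Lemma filtrationN n : n < 0 -> F n = fullv. Proof. by rewrite /F => ->. Qed.

Lemma filtration_gt1 n : 1 < n -> F n = 0%VS.
Proof. by move=> n1; rewrite /F !ifN//; lia. Qed.

Variant filtration_spec n : {vspace g} -> Prop :=
  | FiltrationFull of n < 0 : filtration_spec n fullv
  | FiltrationP of n = 0 : filtration_spec n P
  | FiltrationN of n = 1 : filtration_spec n N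
  | Filtration0 of 1 < n : filtration_spec n 0%VS.

Lemma filtrationP n : filtration_spec n (F n).
Proof.
rewrite /F; case: ltP => n0; first by constructor.
case: eqP => n0'; first by constructor.
by case: eqP => n1; constructor => //; lia.
Qed.

End Filtration.

Section ParabolicEvaluation.
Variables (K : fieldType) (g : vectType K) (br : {bilinear g -> g -> g}).
Hypothesis br_lie : lie_bracket br.
Hypothesis nondeg : killing_nondeg br.
Variables P N : {vspace g}.
Hypothesis subNP : (N <= P)%VS.
Hypothesis brPP : forall x y, x \in P -> y \in P -> br x y \in P.
Hypothesis brNN : forall x y, x \in N -> y \in N -> br x y = 0.
Hypothesis perpN : forall x, (forall y, y \in N -> killing br x y = 0) -> x \in P.
Hypothesis orthPN : forall x y, x \in P -> y \in N -> killing br x y = 0.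
Implicit Types (f q : int -> g) (x y z : g) (m n : int).

Local Notation kf := (killing br).
Local Notation Q := (loop_double_form br (geometric K)).
Local Notation loopbr := (loop_double_bracket br).

Local Notation F := (filtration P N).

Lemma parabolic_orth x : (forall y, y \in P -> kf x y = 0) -> x \in N.
Proof.
move=> Px; apply: (killing_biorthogonal nondeg) => y Ny.
by rewrite killingC Px// perpN.
Qed.

Lemma brPN x y : x \in P -> y \in N -> br x y \in N.
Proof.
move=> Px Ny; apply: parabolic_orth => z Pz.
by rewrite killing_ad// killingC orthPN ?oppr0// brPP.
Qed.

Lemma br_fullN x y : y \in N -> br x y \in P.
Proof.
move=> Ny; apply: perpN => z Nz.
by rewrite killing_invariant// brNN// killing0r.
Qed.

Lemma filtration_anti m n : m <= n -> (F n <= F m)%VS.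
Proof.
case: (filtrationP P N m) => mE le_mn; first exact: subvf.
- by case: (filtrationP P N n) => // nE; rewrite ?sub0v//; lia.
- by case: (filtrationP P N n) => // nE; rewrite ?sub0v//; lia.
- by case: (filtrationP P N n) => // nE; lia.
Qed.

Lemma filtration_orth m n x y : 0 < m + n -> x \in F m -> y \in F n -> kf x y = 0.
Proof.
case: (filtrationP P N m) => mE lt0; case: (filtrationP P N n) => nE; try lia.
all: rewrite ?memv0 => Hx Hy.
all: try by rewrite (eqP Hx) killing0l.
all: try by rewrite (eqP Hy) killing0r.
- exact: orthPN.
- by rewrite killingC orthPN.
- by rewrite orthPN// (subvP subNP).
Qed.

Lemma filtration_br m n x y : x \in F m -> y \in F n -> br x y \in F (m + n).
Proof.
case: (filtrationP P N m) => mE; case: (filtrationP P N n) => nE Hx Hy;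
  case: (filtrationP P N (m + n)) => mnE; rewrite ?memvf//; try lia;
  try (by move: Hx; rewrite memv0 => /eqP ->; rewrite linear0l mem0v);
  try (by move: Hy; rewrite memv0 => /eqP ->; rewrite linear0r mem0v).
- exact: br_fullN.
- exact: brPP.
- exact: brPN.
- by rewrite bracketC// memvN br_fullN.
- by rewrite bracketC// memvN brPN.
- by rewrite brNN// mem0v.
Qed.

Lemma filtration_perp n x : (forall y, y \in F n -> kf x y = 0) -> x \in F (1 - n).
Proof.
case: (filtrationP P N n) => nE Hx; case: (filtrationP P N (1 - n)) => mE;
  rewrite ?memvf//; try lia.
- by rewrite memv0; apply/eqP/nondeg => y; rewrite Hx// memvf.
- exact: parabolic_orth.
- exact: perpN.
Qed.

Definition filtered f : Prop := laurent f /\ forall n, f n \in F n.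

Lemma filtered_bound f : filtered f ->
  exists b : nat, forall n, b%:Z < `|n| -> f n = 0.
Proof.
move=> [/laurent_bound[b f0] fF]; exists b.+1 => n nb.
have [n0|n0] := ltP n 0; first by apply: f0; lia.
by have := fF n; rewrite filtration_gt1 ?memv0 => [/eqP|]//; lia.
Qed.

Lemma filtered_bound2 f q : filtered f -> filtered q ->
  exists b : nat, forall n, b%:Z < `|n| -> f n = 0 /\ q n = 0.
Proof.
move=> /filtered_bound[b fb] /filtered_bound[c qc]; exists (b + c)%N => n nb.
by split; [apply: fb|apply: qc]; lia.
Qed.

Lemma filtered_lin (a : K) f q : filtered f -> filtered q -> filtered (a *: f + q).
Proof.
move=> [fL fF] [qL qF]; split=> [|n]; last first.
  by rewrite !fctE; apply: memvD; rewrite ?memvZ ?fF.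
apply: laurentD qL; case: fL => M fM; exists M => m /fM fm.
by rewrite !fctE fm scaler0.
Qed.

Lemma filtered0 : filtered 0.
Proof. by split=> [|n]; rewrite ?mem0v//; exists 0. Qed.

Lemma filteredB f q : filtered f -> filtered q -> filtered (f - q).
Proof. by move=> fO qO; rewrite addrC -scaleN1r; apply: filtered_lin. Qed.

Lemma filteredD f q : filtered f -> filtered q -> filtered (f + q).
Proof. by move=> fO qO; rewrite -[f]scale1r; apply: filtered_lin. Qed.

Lemma filtered_single n x : x \in F n -> filtered (single n x).
Proof.
move=> Fx; split=> [|m]; first exact: single_laurent.
by rewrite /single; case: eqP => [->|_]; rewrite ?mem0v.
Qed.

Lemma eval1_lin (a : K) f q : filtered f -> filtered q ->
  eval1 (a *: f + q) = a *: eval1 f + eval1 q.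
Proof.
move=> fO qO; have [b fqb] := filtered_bound2 fO qO.
rewrite /eval1 !(@fsum_window _ b).
- by rewrite scaler_sumr -big_split.
- by move=> i /fqb[].
- by move=> i /fqb[].
- by move=> i /fqb[fi qi]; rewrite !fctE fi qi scaler0 addr0.
Qed.

Lemma eval1_0 : eval1 (0 : int -> g) = 0.
Proof. by rewrite /eval1 fsbig1. Qed.

Lemma eval1B f q : filtered f -> filtered q -> eval1 (f - q) = eval1 f - eval1 q.
Proof. by move=> fO qO; rewrite addrC -scaleN1r eval1_lin// scaleN1r addrC. Qed.

Lemma eval1D f q : filtered f -> filtered q -> eval1 (f + q) = eval1 f + eval1 q.
Proof. by move=> fO qO; rewrite -[f in LHS]scale1r eval1_lin// scale1r. Qed.

Lemma filtered_br f q : filtered f -> filtered q -> filtered (convol br f q).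
Proof.
move=> fO qO; have [b fqb] := filtered_bound2 fO qO.
have convE m : convol br f q m = \sum_(i <- window b) br (f i) (q (m - i)).
  by rewrite /convol (@fsum_window _ b)// => i /fqb[-> _]; rewrite linear0l.
split=> [|m].
  exists (- (b + b)%:Z) => m mb; rewrite convE big_seq big1// => i.
  rewrite mem_window => ib; have /fqb[_ ->] : b%:Z < `|m - i| by lia.
  by rewrite linear0r.
rewrite convE memv_suml// => i _.
by have := filtration_br (fO.2 i) (qO.2 (m - i)); rewrite subrKC.
Qed.

Lemma eval1_br f q : filtered f -> filtered q ->
  eval1 (convol br f q) = br (eval1 f) (eval1 q).
Proof.
move=> fO qO; have [b fqb] := filtered_bound2 fO qO.
have convE m : convol br f q m = \sum_(i <- window b) br (f i) (q (m - i)).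
  by rewrite /convol (@fsum_window _ b)// => i /fqb[-> _]; rewrite linear0l.
rewrite {1}/eval1 (@fsum_window _ (b + b)); last first.
  move=> m mb; rewrite convE big_seq big1// => i.
  rewrite mem_window => ib; have /fqb[_ ->] : b%:Z < `|m - i| by lia.
  by rewrite linear0r.
rewrite (eq_bigr _ (fun m _ => convE m)) exchange_big/=.
rewrite [in RHS]/eval1 (@fsum_window _ b) => [|i /fqb[]//].
rewrite linear_sumlz; apply: eq_big_seq => i; rewrite mem_window => ib.
rewrite -linear_sumr; congr (br _ _).
rewrite /eval1 (@reindex_fsbigT _ _ _ _ _ (fun m => m - i)); last first.
  by exists (fun m => m + i) => m; rewrite ?addrK ?subrK.
by rewrite (@fsum_window _ (b + b))// => m mb; have /fqb[_ ->] : b%:Z < `|m - i| by lia.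
Qed.

(** The terms that a partial sum leaves out are orthogonal to the coefficient that
    it is paired with, so the form only sees values at [u = 1]. *)
Lemma loop_double_form_eval1 f q x y : filtered f -> filtered q ->
  Q (f, x) (q, y) = double_form br (eval1 f, x) (eval1 q, y).
Proof.
move=> fO qO; rewrite loop_double_formE; [|exact: fO.1|exact: qO.1].
rewrite /double_form/=; congr (_ - _).
have [b fqb] := filtered_bound2 fO qO.
have f0 i : b%:Z < `|i| -> f i = 0 by move=> /fqb[].
have q0 i : b%:Z < `|i| -> q i = 0 by move=> /fqb[].
rewrite [eval1 f]/eval1 (fsum_window f0) killing_suml.
rewrite (@fsum_window _ b) => [|i /f0 ->]; last by rewrite killing0l.
apply: eq_bigr => i _; apply/eqP; rewrite eq_sym -subr_eq0 -killingBr; apply/eqP.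
apply: (@filtration_orth i (1 - i)) => //; [by lia|exact: fO.2|].
rewrite /eval1 /partial_sum (fsum_window q0) (@fsum_window _ b); last first.
  by move=> j /q0 ->; rewrite if_same.
rewrite -sumrB memv_suml// => j _; case: ifP => ji; first by rewrite subrr mem0v.
by rewrite subr0; apply: (subvP (filtration_anti _)) (qO.2 j); lia.
Qed.

Lemma step_filtered n z : z \in F (n + 1) -> filtered (single n z - single (n + 1) z).
Proof.
move=> Fz; apply: filteredB; apply: filtered_single => //.
by apply: (subvP (filtration_anti _)) Fz; lia.
Qed.

(** The order is the orthogonal of the kernel of evaluation: the elements
    [u^n (1 - u) z] of that kernel already test every coefficient of [f]. *)
Lemma filtered_perp f x : laurent f ->
  (forall q, filtered q -> eval1 q = 0 -> Q (f, x) (q, 0) = 0) -> filtered f.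
Proof.
move=> fL Hf; split=> // n.
have /filtration_perp : forall y, y \in F (1 - n) -> kf (f n) y = 0.
  move=> y; rewrite addrC => Fy.
  rewrite -[n]opprK -(loop_double_form_step _ x) ?opprK//.
  have sF := step_filtered Fy; apply: Hf => //.
  rewrite eval1B ?eval1_single ?subrr//; apply: filtered_single => //.
  by apply: (subvP (filtration_anti _)) Fy; lia.
by rewrite subKr.
Qed.

Definition same_reductive : set (g * g) :=
  [set p | [/\ p.1 \in P, p.2 \in P & p.1 - p.2 \in N]].

(** The order meets [g[[u]]] in the polynomials [y + u z] with [y] in [P] and [z]
    in [N]; evaluation at 1 and at 0 identifies them with the pairs having the
    same reductive part. *)
Definition current_lift (p : g * g) : int -> g := single 0 p.2 + single 1 (p.1 - p.2).

Lemma current_lift_filtered p : same_reductive p -> filtered (current_lift p).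
Proof.
by case=> _ Pp Np; apply: filteredD; apply: filtered_single; rewrite /=.
Qed.

Lemma current_lift_current p : current_algebra g (current_lift p, p.2).
Proof.
exists (current_lift p).
  by move=> m m0; rewrite /current_lift !fctE /single !ifN ?addr0//; lia.
by rewrite /current_lift !fctE /single eqxx/= addr0.
Qed.

Lemma eval1_lift p : same_reductive p -> eval1 (current_lift p) = p.1.
Proof.
case=> _ Pp Np; rewrite eval1D ?eval1_single ?subrKC//;
  by apply: filtered_single; rewrite /=.
Qed.

Lemma current_liftE f : filtered f -> power_series f ->
  same_reductive (eval1 f, f 0) /\ f = current_lift (eval1 f, f 0).
Proof.
move=> fO fP; have fE : f = single 0 (f 0) + single 1 (f 1).
  apply/funext => n; rewrite !fctE /single; case: (ltgtP n 0) => [n0|n0|->].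
  - by rewrite fP// ifN ?addr0//; lia.
  - case: eqP => [->|n1]; first by rewrite add0r.
    have := fO.2 n; rewrite filtration_gt1 ?memv0; last by lia.
    by move=> /eqP ->; rewrite addr0.
  - by rewrite eq_sym oner_eq0 addr0.
have f0P : f 0 \in P := fO.2 0.
have f1N : f 1 \in N := fO.2 1.
have fT : eval1 f = f 0 + f 1.
  by rewrite [in LHS]fE eval1D ?eval1_single//; apply: filtered_single.
split.
  split=> //=; rewrite fT; last by rewrite addrC addKr.
  by rewrite memvD// (subvP subNP).
by rewrite /current_lift/= fT [f 0 + f 1]addrC addrK.
Qed.

Definition evaluate (p : (int -> g) * g) : g * g := (eval1 p.1, p.2).

Definition loop_lagrangians : set (set ((int -> g) * g)) :=
  [set W | [/\ lagrangian (loop_double g) loopbr Q W,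
     transversal_subspaces (loop_double g) W (current_algebra g) &
     forall p, W p -> filtered p.1]].

Definition double_lagrangians : set (set (g * g)) :=
  [set L | lagrangian setT (double_bracket br) (double_form br) L /\
     transversal_subspaces setT L same_reductive].

Definition preimage_loop (L : set (g * g)) : set ((int -> g) * g) :=
  [set p | filtered p.1 /\ L (evaluate p)].

(** As [W] lies in the order, [W = W^perp] contains the orthogonal of the order;
    the kernel is part of it since the form only sees evaluations. *)
Lemma loop_lagrangian_kernel W p : loop_lagrangians W ->
  filtered p.1 -> evaluate p = 0 -> W p.
Proof.
move=> [[_ WE] _ WO] pO /eqP; rewrite xpair_eqE => /andP[/eqP p1 /eqP p2].
rewrite WE; split; first exact: pO.1.
case: p p1 p2 pO => p1 p2 /= p10 p20 pO [w1 w2] Ww.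
rewrite loop_double_form_eval1//; last exact: (WO _ Ww).
by rewrite /double_form/= p10 p20 !killing0l subr0.
Qed.

Lemma loop_lagrangianE W : loop_lagrangians W ->
  W = preimage_loop (evaluate @` W).
Proof.
move=> WL; have [[[WA W0 Wlin Wbr] WE] _ WO] := WL.
rewrite eqEsubset; split=> p.
  by move=> Wp; split; [exact: WO|exists p].
case=> pO [w Ww wE].
have -> : p = 1 *: (p - w) + w by rewrite scale1r subrK.
apply: Wlin => //; apply: loop_lagrangian_kernel => //.
  by apply: filteredB => //; apply: WO.
move: wE; rewrite /evaluate/= eval1B//; last exact: WO.
by case=> -> ->; rewrite !subrr.
Qed.

Lemma evaluate_surj (p : g * g) : exists2 f, filtered f & evaluate (f, p.2) = p.
Proof.
exists (single (-1) p.1); first by apply: filtered_single; rewrite filtrationN ?memvf.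
by rewrite /evaluate eval1_single; case: p.
Qed.

(** Transversality passes to the image because a power series that differs from
    an element of the order by an element of [W] is itself in the order. *)
Lemma evaluate_lagrangian W : loop_lagrangians W -> double_lagrangians (evaluate @` W).
Proof.
move=> WL; have [[[WA W0 Wlin Wbr] WE] [Wsum Wcap] WO] := WL.
have WP f x : filtered f -> (evaluate @` W) (eval1 f, x) -> W (f, x).
  by move=> fO Hf; rewrite (loop_lagrangianE WL).
split; split.
- split=> //.
  + by exists 0 => //; rewrite /evaluate/= eval1_0.
  + move=> a _ _ [p Wp <-] [q Wq <-]; exists (a *: p + q); first exact: Wlin.
    by rewrite /evaluate/= eval1_lin//; apply: WO.
  + move=> _ _ [p Wp <-] [q Wq <-]; exists (loopbr p q); first exact: Wbr.
    by rewrite /evaluate/= eval1_br//; apply: WO.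
- rewrite eqEsubset; split=> [_ [p Wp <-]|p [_ Hp]].
    split=> // _ [q Wq <-]; move: (Wp); rewrite {1}WE => -[_ /(_ _ Wq)].
    case: p q Wp Wq => [p1 p2] [q1 q2] Wp Wq; rewrite loop_double_form_eval1//.
      exact: (WO _ Wp).
    exact: (WO _ Wq).
  have [f fO fp] := evaluate_surj p; exists (f, p.2) => //.
  rewrite WE; split; first exact: fO.1.
  move=> [q1 q2] Wq; rewrite loop_double_form_eval1//; last exact: (WO _ Wq).
  by rewrite -/(evaluate (f, p.2)) fp; apply: Hp; exists (q1, q2).
- rewrite eqEsubset; split=> // p _.
  have [f fO fp] := evaluate_surj p.
  have : loop_double g (f, p.2) by exact: fO.1.
  rewrite Wsum => -[w Ww [_ [d dP ->]] dE].
  have wO := WO _ Ww.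
  have dO : filtered d.
    have -> : d = f - w.1 by case: dE => <- _; rewrite addrC addKr.
    exact: filteredB.
  have [dS _] := current_liftE dO dP.
  exists (evaluate w); first by exists w.
  exists (eval1 d, d 0) => //.
  rewrite -fp -dE /evaluate; case: w {Ww dE} wO => w1 w2 /= wO.
  by rewrite eval1D.
- rewrite eqEsubset; split=> p; last first.
    move=> ->; split; last by split; rewrite ?subr0 mem0v.
    by exists 0 => //; rewrite /evaluate/= eval1_0.
  case=> [Lp Dp].
  have Wd : W (current_lift p, p.2).
    by apply: WP; [exact: current_lift_filtered|rewrite eval1_lift//; case: p Lp Dp].
  have : (W `&` current_algebra g) (current_lift p, p.2).
    by split=> //; exact: current_lift_current.
  rewrite Wcap => -[l0 p20]; case: p p20 Lp Dp l0 {Wd} => p1 p2 /= -> _ Dp l0.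
  by have := eval1_lift Dp; rewrite l0 eval1_0 /= => <-.
Qed.

(** The preimage is self-orthogonal because its orthogonal lies in the order by
    [filtered_perp], where the form is pulled back by evaluation.  It is a
    complement of [g[[u]]] since negative powers of [u] are all in the order. *)
Lemma preimage_lagrangian L : double_lagrangians L -> loop_lagrangians (preimage_loop L).
Proof.
move=> [[[_ L0 Llin Lbr] LE] [Lsum Lcap]].
have sub A B : L A -> L B -> L (A - B).
  by move=> LA LB; rewrite addrC -scaleN1r; apply: Llin.
split=> [||p []//]; split.
- split.
  + by move=> p [[]].
  + by split; [exact: filtered0|rewrite /evaluate eval1_0].
  + move=> a p q [pO Lp] [qO Lq]; split; first exact: filtered_lin.
    by rewrite /evaluate eval1_lin//; apply: Llin Lp Lq.
  + move=> p q [pO Lp] [qO Lq]; split; first exact: filtered_br.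
    by rewrite /evaluate eval1_br//; apply: Lbr Lp Lq.
- rewrite eqEsubset; split=> [[p1 p2] [pO Lp]|[p1 p2] [pA Hp]].
    split; first exact: pO.1.
    move=> [q1 q2] [qO Lq]; rewrite loop_double_form_eval1//.
    by move: Lp; rewrite {1}LE => -[_]; apply.
  have pO : filtered p1.
    apply: (@filtered_perp _ p2) => // q qO q0; apply: Hp; split=> //.
    by rewrite /evaluate/= q0.
  split=> //; rewrite LE; split=> // q Lq.
  have [f fO fq] := evaluate_surj q; rewrite -fq -loop_double_form_eval1//.
  by apply: Hp; split=> //; rewrite fq.
- rewrite eqEsubset; split=> [[f x] fL|_ [[p1 p2] [pO Lp]] [_ [d dP ->]] <-]; last first.
    apply: laurentD; first exact: pO.1.
    by exists 0.
  pose fm : int -> g := fun n => if n < 0 then f n else 0.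
  have fmO : filtered fm.
    split=> [|n]; last first.
      by rewrite /fm; case: ifP => n0; rewrite ?mem0v// filtrationN ?memvf.
    by case: fL => M fM; exists M => m ltm; rewrite /fm (_ : f m = 0) ?if_same//; exact: fM.
  have fpP : power_series (f - fm).
    by move=> m m0; rewrite !fctE /fm m0 subrr.
  have : [set: g * g] (evaluate (fm, x - f 0)) by [].
  rewrite Lsum => -[l Ll [d Dd dE]].
  exists (fm - current_lift d, x - f 0 - d.2).
    split; first by apply: filteredB => //; apply: current_lift_filtered.
    rewrite /evaluate/= eval1B//; last exact: current_lift_filtered.
    rewrite eval1_lift//.
    suff -> : (eval1 fm - d.1, x - f 0 - d.2) = l by [].
    have -> : (eval1 fm - d.1, x - f 0 - d.2) = evaluate (fm, x - f 0) - d by [].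
    by rewrite -dE addrK.
  exists (f - fm + current_lift d, f 0 + d.2).
    have [e eP [-> e0]] := current_lift_current d.
    exists (f - fm + e).
      by move=> m m0; rewrite -[LHS]/((f - fm) m + e m) fpP// eP// addr0.
    rewrite !fctE -e0; congr (_, _ + _).
    by rewrite /fm ltxx subr0.
  by congr (_, _); [rewrite addrACA subrKC addNr addr0|rewrite [f 0 + _]addrC addrA !subrK].
- rewrite eqEsubset; split=> p; last first.
    move=> ->; split; last by exists 0.
    by split; [exact: filtered0|rewrite /evaluate eval1_0].
  case=> [[pO Lp]] [f fP pE]; move: pO Lp; rewrite pE /= => fO Lf.
  have [fD fE] := current_liftE fO fP.
  have : (L `&` same_reductive) (eval1 f, f 0) by [].
  rewrite Lcap => -[tf f0].
  have current_lift0 : current_lift (0, 0) = 0.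
    by apply/funext => n; rewrite /current_lift /= subrr !fctE /single !if_same addr0.
  by rewrite /= fE tf f0 current_lift0.
Qed.

Theorem evaluate_bij : set_bij loop_lagrangians double_lagrangians
  (fun W => evaluate @` W).
Proof.
split.
- by move=> W; apply: evaluate_lagrangian.
- move=> W W'; rewrite !inE => WL W'L eqW.
  by rewrite (loop_lagrangianE WL) (loop_lagrangianE W'L) eqW.
- move=> L LL; exists (preimage_loop L); first exact: preimage_lagrangian.
  rewrite eqEsubset; split=> [_ [p [pO Lp] <-]//|p Lp].
  have [f fO fp] := evaluate_surj p.
  by exists (f, p.2) => //; split=> //; rewrite fp.
Qed.

End ParabolicEvaluation.

(** * Products of shifted adjoint operators *)
Section ShiftedAdjoint.
Variables (K : fieldType) (g : vectType K) (br : {bilinear g -> g -> g}).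
Hypothesis br_lie : lie_bracket br.
Implicit Types (x y t : g) (s : seq (g * K)) (mu : g * K -> K).

(** The composite of the operators [ad h - c] for [(h, c)] in [s].  The elements
    [h] may not commute, so this is a list rather than a polynomial. *)
Definition ad_prod s x := foldr (fun p y => br p.1 y - p.2 *: y) x s.

Lemma ad_prod_cat s1 s2 x : ad_prod (s1 ++ s2) x = ad_prod s1 (ad_prod s2 x).
Proof. exact: foldr_cat. Qed.

Lemma ad_prodD s x y : ad_prod s (x + y) = ad_prod s x + ad_prod s y.
Proof.
elim: s => //= p s ->.
by rewrite linearDr scalerDr opprD addrACA.
Qed.

Lemma ad_prod0 s : ad_prod s 0 = 0.
Proof. by elim: s => //= p s ->; rewrite linear0r scaler0 subr0. Qed.

Lemma ad_prod_sum I (r : seq I) (F : I -> g) s :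
  ad_prod s (\sum_(i <- r) F i) = \sum_(i <- r) ad_prod s (F i).
Proof. exact: (big_morph _ (ad_prodD s) (ad_prod0 s)). Qed.

Lemma ad_prod_eigen s mu x : {in s, forall p, br p.1 x = mu p *: x} ->
  ad_prod s x = (\prod_(p <- s) (mu p - p.2)) *: x.
Proof.
elim: s => [|p s IH] muE /=; first by rewrite big_nil scale1r.
rewrite IH => [|q qs]; last by rewrite muE// inE qs orbT.
rewrite linearZr_LR muE ?mem_head// !scalerA -scalerBl big_cons.
by rewrite mulrBl mulrC.
Qed.

Lemma ad_prod_ind (Pr : g -> Prop) s x :
  {in s, forall p y, Pr y -> Pr (br p.1 y - p.2 *: y)} -> Pr x -> Pr (ad_prod s x).
Proof.
move=> sPr Px; elim: s sPr => //= p s IH sPr.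
apply: (sPr); first exact: mem_head.
by apply: IH => q qs; apply: sPr; rewrite inE qs orbT.
Qed.

Lemma ad_prodZ s a x : ad_prod s (a *: x) = a *: ad_prod s x.
Proof.
by elim: s => //= p s ->; rewrite linearZr_LR scalerBr !scalerA [_ * a]mulrC.
Qed.

Lemma killing_ad_prod s mu x y : {in s, forall p, br p.1 y = mu p *: y} ->
  killing br (ad_prod s x) y = (\prod_(p <- s) - (mu p + p.2)) * killing br x y.
Proof.
elim: s => [|p s IH] muE /=; first by rewrite big_nil mul1r.
rewrite killingBl killing_ad// muE ?mem_head// killingZr killingZl.
rewrite IH => [|q qs]; last by rewrite muE// inE qs orbT.
by rewrite -opprD -mulrDl -mulNr mulrA big_cons.
Qed.

(** The factors of the polynomial with roots [cs], evaluated at [ad t]. *)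
Definition poly_ad t (cs : seq K) : seq (g * K) := [seq (t, c) | c <- cs].

Lemma poly_ad_eigen t cs a x : br t x = a *: x ->
  ad_prod (poly_ad t cs) x = (\prod_(c <- cs) (a - c)) *: x.
Proof.
move=> tx; rewrite (@ad_prod_eigen _ (fun=> a)) => [|_ /mapP[c _ ->]//].
by rewrite big_map.
Qed.

Lemma poly_ad_cat t cs ds x : ad_prod (poly_ad t (cs ++ ds)) x =
  ad_prod (poly_ad t cs) (ad_prod (poly_ad t ds) x).
Proof. by rewrite /poly_ad map_cat ad_prod_cat. Qed.

Lemma poly_ad_comm1 t cs x :
  ad_prod (poly_ad t cs) (br t x) = br t (ad_prod (poly_ad t cs) x).
Proof. by elim: cs => //= c cs ->; rewrite linearBr linearZr_LR. Qed.

Lemma poly_ad_comm t cs ds x : ad_prod (poly_ad t cs) (ad_prod (poly_ad t ds) x) =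
  ad_prod (poly_ad t ds) (ad_prod (poly_ad t cs) x).
Proof.
elim: ds => //= d ds <-.
rewrite ad_prodD poly_ad_comm1; congr (_ + _).
elim: (poly_ad t cs) => //= p s ->.
by rewrite linearNr linearZr_LR scalerN !scalerBr scalerA mulrC -scalerA opprB opprK addrC.
Qed.

(** Bezout for two split polynomials in [ad t], by peeling off one root. *)
Lemma poly_ad_coprime t cs ds x : {in cs & ds, forall c d, c != d} ->
  ad_prod (poly_ad t cs) x = 0 -> ad_prod (poly_ad t ds) x = 0 -> x = 0.
Proof.
elim: cs => //= c cs IH cds /eqP; rewrite subr_eq0 => /eqP csx dsx.
apply: IH => // [a b acs bds|]; first by apply: cds; rewrite ?inE ?acs ?orbT.
have := poly_ad_eigen ds csx; rewrite poly_ad_comm dsx ad_prod0 => /esym/eqP.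
rewrite scaler_eq0 => /orP[|/eqP//].
rewrite prodf_seq_eq0 => /hasP[d dds /=]; rewrite subr_eq0 => /eqP cd.
by have := cds _ _ (mem_head c cs) dds; rewrite cd eqxx.
Qed.

(** [ad t] is a derivation: on brackets with a [c]-eigenvector, [ad t - c] acts as
    [ad t] on the other factor. *)
Lemma poly_ad_br t c n x y : br t y = c *: y ->
  ad_prod (poly_ad t (nseq n c)) (br x y) = br (ad_prod (poly_ad t (nseq n 0)) x) y.
Proof.
move=> ty; elim: n => //= n ->.
by rewrite jacobi// ty linearZr_LR addrK scale0r subr0.
Qed.

Lemma killing_eigen t a b x y : br t x = a *: x -> br t y = b *: y -> a + b != 0 ->
  killing br x y = 0.
Proof.
move=> tx ty ab; apply/eqP.
have := killing_ad_prod (s := [:: (t, 0)]) (mu := fun=> b) x (y := y).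
rewrite /= big_seq1 scale0r subr0 addr0 tx killingZl => /(_ _)/eqP.
rewrite mulNr -addr_eq0 -mulrDl mulf_eq0 (negPf ab) /=; apply.
by move=> p; rewrite inE => /eqP ->.
Qed.

Lemma killing_nilp_eigen t n b x y : ad_prod (poly_ad t (nseq n 0)) x = 0 ->
  br t y = b *: y -> b != 0 -> killing br x y = 0.
Proof.
move=> tx ty b0.
have : killing br (ad_prod (poly_ad t (nseq n 0)) x) y =
    (\prod_(p <- poly_ad t (nseq n 0)) - (b + p.2)) * killing br x y.
  by apply: (@killing_ad_prod _ (fun=> b)) => _ /mapP[c _ ->].
rewrite tx killing0l => /esym/eqP.
rewrite mulf_eq0 prodf_seq_eq0 => /orP[/hasP[p /mapP[c]]|/eqP//].
by rewrite mem_nseq => /andP[_ /eqP ->] -> /=; rewrite addr0 oppr_eq0 (negPf b0).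
Qed.

End ShiftedAdjoint.

(** * Separation of weights *)
Section Weights.
Variables (K : numFieldType) (g : vectType K) (br : {bilinear g -> g -> g}).
Hypothesis br_lie : lie_bracket br.
Variable H : {vspace g}.
Implicit Types (beta gamma : dual H) (h : subvs_of H).

Lemma separate_ex beta gamma : exists h, beta != gamma -> beta h != gamma h.
Proof.
have [->|bg] := eqVneq beta gamma; first by exists 0.
apply: contrapT => /forallNP Hn; case/eqP: bg; apply/lfunP => h.
by apply: contrapT => hn; apply: (Hn h) => _; apply/eqP.
Qed.

Definition separator beta gamma : subvs_of H := projT1 (cid (separate_ex beta gamma)).

Lemma separatorP beta gamma : beta != gamma ->
  beta (separator beta gamma) != gamma (separator beta gamma).
Proof. exact: (projT2 (cid (separate_ex beta gamma))). Qed.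

(** Acting through these with [sgn = 1] kills the root spaces of the weights of
    [B] other than [beta] and rescales that of [beta]; with [sgn = -1] it does so
    after pairing with the root spaces, as [ad h] is skew for the form. *)
Definition projector (sgn : K) beta (B : seq (dual H)) : seq (g * K) :=
  [seq (vsval (separator beta gamma), sgn * gamma (separator beta gamma))
     | gamma <- B & gamma != beta].

Lemma projector_kill beta B gamma x : gamma \in B -> gamma != beta ->
  x \in root_space br gamma -> ad_prod br (projector 1 beta B) x = 0.
Proof.
move=> gB gb /mem_root_space xg.
rewrite (@ad_prod_eigen _ _ _ _ (fun p => gamma (vsproj H p.1))); last first.
  by move=> _ /mapP[d _ ->] /=; rewrite xg vsvalK.
apply/eqP; rewrite scaler_eq0 prodf_seq_eq0; apply/orP; left; apply/hasP.
exists (vsval (separator beta gamma), 1 * gamma (separator beta gamma)).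
  by apply/mapP; exists gamma; rewrite ?mem_filter ?gb.
by rewrite /= vsvalK mul1r subrr.
Qed.

Lemma projector_fix beta B : exists2 c : K, c != 0 &
  forall x, x \in root_space br beta -> ad_prod br (projector 1 beta B) x = c *: x.
Proof.
exists (\prod_(p <- projector 1 beta B) (beta (vsproj H p.1) - p.2)).
  rewrite prodf_seq_neq0; apply/allP => _ /mapP[gamma + ->].
  rewrite mem_filter => /andP[gb _] /=.
  by rewrite vsvalK mul1r subr_eq0 separatorP// eq_sym.
move=> x /mem_root_space xb.
rewrite (@ad_prod_eigen _ _ _ _ (fun p => beta (vsproj H p.1)))//.
by move=> _ /mapP[d _ ->] /=; rewrite xb vsvalK.
Qed.

Lemma projector_kill_dual beta B gamma x y : gamma \in B -> gamma != beta ->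
  y \in root_space br gamma -> killing br (ad_prod br (projector (-1) beta B) x) y = 0.
Proof.
move=> gB gb /mem_root_space xg.
rewrite (@killing_ad_prod _ _ _ br_lie _ (fun p => gamma (vsproj H p.1))); last first.
  by move=> _ /mapP[d _ ->] /=; rewrite xg vsvalK.
apply/eqP; rewrite mulf_eq0 prodf_seq_eq0; apply/orP; left; apply/hasP.
exists (vsval (separator beta gamma), -1 * gamma (separator beta gamma)).
  by apply/mapP; exists gamma; rewrite ?mem_filter ?gb.
by rewrite /= vsvalK mulN1r subrr oppr0.
Qed.

Lemma projector_fix_dual beta B : exists2 c : K, c != 0 &
  forall x y, y \in root_space br beta ->
  killing br (ad_prod br (projector (-1) beta B) x) y = c * killing br x y.
Proof.
exists (\prod_(p <- projector (-1) beta B) - (beta (vsproj H p.1) + p.2)).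
  rewrite prodf_seq_neq0; apply/allP => _ /mapP[gamma + ->].
  rewrite mem_filter => /andP[gb _] /=.
  by rewrite vsvalK mulN1r oppr_eq0 subr_eq0 separatorP// eq_sym.
move=> x y /mem_root_space xb.
rewrite (@killing_ad_prod _ _ _ br_lie _ (fun p => beta (vsproj H p.1)))//.
by move=> _ /mapP[d _ ->] /=; rewrite xb vsvalK.
Qed.

(** Weight vectors of distinct weights are independent, as the projectors
    show. *)
Lemma finite_roots : finite_set (roots br (H := H)).
Proof.
apply: contrapT => /(infinite_set_fset (\dim {:g}).+1)[B Broots].
set s := (X in size X) => ltds.
have s_uniq : uniq s by exact: finmap.fset_uniq.
have sroots beta : beta \in s -> root_space br beta != 0%VS.
  by move=> bs; have [] := Broots beta bs.
pose X := [tuple of [seq vpick (root_space br beta) | beta <- in_tuple s]].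
have : free X.
  apply/freeP => c cX i; pose beta := tnth (in_tuple s) i.
  have bs : beta \in s by apply: mem_tnth.
  have XE (n : 'I_(size s)) : X`_n = vpick (root_space br (tnth (in_tuple s) n)).
    by rewrite -(tnth_nth 0 X n) tnth_map.
  have tnth_inj : injective (tnth (in_tuple s)) by apply/tuple_uniqP.
  have Xmem (n : 'I_(size s)) :
      c n *: X`_n \in root_space br (tnth (in_tuple s) n).
    by rewrite memvZ// XE memv_pick.
  have [a a0 aE] := projector_fix beta s.
  have := congr1 (ad_prod br (projector 1 beta s)) cX.
  rewrite ad_prod0 ad_prod_sum (bigD1 i)//= big1 => [|n ni].
    rewrite addr0 (aE _ (Xmem i)) => /eqP; rewrite !scaler_eq0 (negPf a0) /=.
    by rewrite XE vpick0 (negPf (sroots _ bs)) orbF => /eqP.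
  apply: projector_kill (Xmem n); first exact: mem_tnth.
  by apply: contra ni => /eqP/tnth_inj ->.
rewrite /free => /eqP dimX; have := dimvS (subvf <<X>>%VS).
by rewrite dimX size_tuple leqNgt ltds.
Qed.

End Weights.

(** * Cartan subalgebras and levels of roots *)
Section CartanNilpotency.
Variables (K : fieldType) (g : vectType K) (br : {bilinear g -> g -> g}).
Variable H : {vspace g}.
Hypothesis H_cartan : cartan_subalgebra br H.

Lemma memv_bracket (U V : {vspace g}) x y :
  x \in U -> y \in V -> br x y \in bracketv br U V.
Proof.
move=> xU yV; rewrite (coord_vbasis xU) (coord_vbasis yV) linear_sumlz.
apply: memv_suml => i _; rewrite linear_sumr; apply: memv_suml => n _.
rewrite linearZl_LR linearZr_LR !memvZ// memv_span//.
by apply/allpairsP; exists ((vbasis U)`_i, (vbasis V)`_n); rewrite !mem_nth ?size_tuple.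
Qed.

Lemma cartan_br x y : x \in H -> y \in H -> br x y \in H.
Proof. by case: H_cartan => /subvP HH _ _ xH yH; apply/HH/memv_bracket. Qed.

Lemma cartan_nilpotent : exists n, forall x y, x \in H -> y \in H ->
  ad_prod br (poly_ad x (nseq n 0)) y = 0.
Proof.
case: H_cartan => _ [n Hn] _; exists n => x y xH yH.
suff : ad_prod br (poly_ad x (nseq n 0)) y \in iter n (bracketv br H) H.
  by rewrite Hn memv0 => /eqP.
elim: n {Hn} => //= n IH; rewrite scale0r subr0; exact: memv_bracket.
Qed.

Lemma cartan_neq0 : (exists x y, br x y != 0) -> H != 0%VS.
Proof.
case=> x [y xy]; apply: contra xy => /eqP H0.
case: H_cartan => _ _ /(_ x); rewrite H0 memv0 => x0.
rewrite (eqP (x0 _)) ?linear0l// => h.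
by rewrite !memv0 => /eqP ->; rewrite linear0r.
Qed.

End CartanNilpotency.

Section Levels.
Variables (K : numFieldType) (g : vectType K) (br : {bilinear g -> g -> g}).
Variables (H : {vspace g}) (l : nat) (Gamma : l.-tuple (dual H)).
Hypothesis Gamma_simple : simple_roots br Gamma.
Variable k : 'I_l -> nat.
Hypothesis k_max : maximal_root br Gamma (\sum_(i < l) Gamma`_i *+ k i).
Variables (j : 'I_l) (hj : subvs_of H).
Hypothesis hj_def : scaled_coweight br Gamma k j hj.
Implicit Types (beta gamma : dual H) (x y : g).

Lemma coord_comb (n : 'I_l -> nat) :
  coord Gamma j (\sum_(i < l) Gamma`_i *+ n i) = (n j)%:R.
Proof.
case: Gamma_simple => Gfree _ _.
rewrite (eq_bigr (fun i => (n i)%:R *: Gamma`_i)) ?coord_sum_free// => i _.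
by rewrite scaler_nat.
Qed.

Lemma comb_val (n : 'I_l -> nat) :
  (\sum_(i < l) Gamma`_i *+ n i) hj = (n j)%:R / (k j)%:R :> K.
Proof.
rewrite sum_lfunE (bigD1 j)//= big1 => [|i ij].
  rewrite addr0 -scaler_nat lfun_simp/= hj_def.2 eqxx /GRing.scale/=.
  by rewrite mul1r.
rewrite -scaler_nat lfun_simp/= hj_def.2 (negPf ij) mul0r.
by rewrite /GRing.scale/= mulr0.
Qed.

Lemma root_coord beta : roots br beta -> exists m : int, coord Gamma j beta = m%:~R.
Proof.
case: (Gamma_simple) => _ _ /[apply] -[] [n nE].
  by exists (n j)%:Z; rewrite nE coord_comb.
by exists (- (n j)%:Z); rewrite -[beta]opprK nE linearN/= coord_comb mulrNz.
Qed.

(** Coefficients of roots at the simple root are integers; recording them as such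
    turns all later comparisons into integer arithmetic. *)
Definition level beta : int := xget 0 [set m : int | coord Gamma j beta = m%:~R].

Lemma coord_level beta : roots br beta -> coord Gamma j beta = (level beta)%:~R.
Proof.
by case/root_coord => m mE; rewrite /level; case: xgetP => // /(_ m).
Qed.

Lemma level_val beta : roots br beta -> beta hj = (level beta)%:~R / (k j)%:R :> K.
Proof.
move=> bR; rewrite -coord_level//.
case: (Gamma_simple) => _ _ /(_ _ bR)[] [n nE]; first by rewrite nE coord_comb comb_val.
by rewrite -[beta]opprK nE linearN/= coord_comb opp_lfunE comb_val mulNr.
Qed.

Lemma nneg_level beta : roots br beta -> nneg_comb Gamma beta -> 0 <= level beta.
Proof.
move=> bR [n nE]; have := coord_level bR.
by rewrite nE coord_comb -[(n j)%:R]/((n j)%:Z%:~R) => /intr_inj <-.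
Qed.

Lemma npos_level beta : roots br beta -> nneg_comb Gamma (- beta) -> level beta <= 0.
Proof.
move=> bR [n nE]; have := coord_level bR.
rewrite -[beta in LHS]opprK linearN/= nE coord_comb -[(n j)%:R]/((n j)%:Z%:~R).
by rewrite -mulrNz => /intr_inj <-; rewrite oppr_le0.
Qed.

Lemma level_max beta : roots br beta -> level beta <= k j.
Proof.
move=> bR; have [_ /(_ _ bR)[n nE]] := k_max.
have := coord_comb n; rewrite -nE linearB/= coord_comb coord_level//.
rewrite -[(k j)%:R]/((k j)%:Z%:~R) -[(n j)%:R]/((n j)%:Z%:~R) -mulrzBr.
by move=> /intr_inj; lia.
Qed.

Lemma containing_level beta : roots br beta ->
  containing Gamma j beta <-> level beta != 0.
Proof. by move=> bR; rewrite /containing/= coord_level// intr_eq0. Qed.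

Lemma simple_level : roots br (Gamma`_j : dual H) /\ level Gamma`_j = 1.
Proof.
case: (Gamma_simple) => Gfree Groots _; split; first exact: Groots.
have := coord_level (Groots j); rewrite coord_free// eqxx.
by rewrite -[true%:R]/(1%:~R) => /intr_inj.
Qed.

End Levels.

Section RootSums.
Variables (K : numFieldType) (g : vectType K) (br : {bilinear g -> g -> g}).
Hypothesis br_lie : lie_bracket br.
Variable H : {vspace g}.
Implicit Types (beta gamma : dual H) (x y : g) (A : set (dual H)).

Definition root_seq : seq (dual H) :=
  undup (projT1 (cid ((finite_seqP _).1 (finite_roots br H)))).

Lemma root_seq_uniq : uniq root_seq.
Proof. exact: undup_uniq. Qed.

Lemma mem_root_seq beta : (beta \in root_seq) <-> roots br beta.
Proof.
rewrite mem_undup; have := projT2 (cid ((finite_seqP _).1 (finite_roots br H))).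
case: (cid _) => /= s ->.
by [].
Qed.

Lemma root_space_sumE A : A `<=` roots br (H := H) ->
  root_space_sum br A = (\sum_(beta <- root_seq | beta \in A) root_space br beta)%VS.
Proof.
move=> AR; rewrite /root_space_sum.
rewrite (fsbigE [seq beta <- root_seq | beta \in A]) ?filter_uniq ?root_seq_uniq//.
- by rewrite big_filter_cond; apply: eq_bigl => beta; rewrite andbb.
- by move=> beta /=; rewrite mem_filter => /andP[/set_mem].
- move=> beta Ab; rewrite mem_filter mem_set//= => /negP[].
  by apply/mem_root_seq/AR.
Qed.

Lemma root_space_sumP A x : A `<=` roots br (H := H) ->
  x \in root_space_sum br A <-> exists F : dual H -> g,
    [/\ forall beta, A beta -> F beta \in root_space br beta,
        forall beta, ~ A beta -> F beta = 0 &
        x = \sum_(beta <- root_seq) F beta].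
Proof.
move=> AR; rewrite root_space_sumE//.
have sub beta : beta \in A -> (root_space br beta <=
    \sum_(beta <- root_seq | beta \in A) root_space br beta)%VS.
  move=> Ab; have bR : beta \in root_seq by apply/mem_root_seq/AR/set_mem.
  by rewrite big_mkcond (big_rem _ bR)/= Ab addvSl.
split=> [|[F [FA F0 ->]]]; last first.
  apply: memv_suml => beta _; have [Ab|nAb] := pselect (A beta).
    by apply: (subvP (sub _ (mem_set Ab))); apply: FA.
  by rewrite F0// mem0v.
have := root_seq_uniq; elim: root_seq x {sub} => [x _|gamma s IH x /= /andP[gs s_uniq]].
  rewrite big_nil memv0 => /eqP ->; exists (fun=> 0); split=> // [beta _|].
    exact: mem0v.
  by rewrite big_nil.
rewrite big_cons; have [Ag|nAg] := boolP (gamma \in A); last first.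
  move=> /IH-/(_ s_uniq)[F [FA F0 ->]]; exists F; split=> //.
  by rewrite big_cons F0 ?add0r// => /mem_set; apply/negP.
move=> /memv_addP[u ug [v /IH-/(_ s_uniq)[F [FA F0 ->]] ->]].
exists (fun beta => if beta == gamma then u else F beta); split=> [beta|beta nA|].
- by case: eqP => [->|_ /FA].
- case: eqP => [bg|_]; last exact: F0.
  by case: nA; rewrite bg; apply: set_mem.
- rewrite big_cons eqxx; congr (_ + _); apply: eq_big_seq => beta bs.
  by case: eqP => // bg; rewrite -bg bs in gs.
Qed.

Lemma root_space_sub_sum A beta : A `<=` roots br (H := H) -> A beta ->
  (root_space br beta <= root_space_sum br A)%VS.
Proof.
move=> AR Ab; rewrite root_space_sumE//.
have bR : beta \in root_seq by apply/mem_root_seq/AR.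
by rewrite big_mkcond (big_rem _ bR)/= mem_set// addvSl.
Qed.

Lemma root_space_sum_ind A (Pr : g -> Prop) : A `<=` roots br (H := H) ->
  Pr 0 -> (forall x y, Pr x -> Pr y -> Pr (x + y)) ->
  (forall beta x, A beta -> x \in root_space br beta -> Pr x) ->
  forall x, x \in root_space_sum br A -> Pr x.
Proof.
move=> AR P0 PD PA x /(root_space_sumP _ AR)[F [FA F0 ->]].
elim/big_rec: _ => // beta y _ Py; apply: (PD) Py.
have [Ab|/F0 ->//] := pselect (A beta); exact: PA Ab (FA _ Ab).
Qed.

Lemma root_space_sumS A A' : A' `<=` roots br (H := H) -> A `<=` A' ->
  (root_space_sum br A <= root_space_sum br A')%VS.
Proof.
move=> AR sAA'; apply/subvP; apply: root_space_sum_ind.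
- exact: subset_trans AR.
- exact: mem0v.
- by move=> x y; apply: memvD.
- move=> beta x /sAA' Ab; exact/subvP/root_space_sub_sum.
Qed.

End RootSums.

(** * Coefficients of the elements of an order *)
Section Tensor.
Variables (K : numFieldType) (g : vectType K).

Lemma val_ge_coef (r : K) phi m : val_ge r phi -> phi m != 0 -> r <= m%:~R.
Proof.
move=> [[N phiN] phir] phim.
have ex : exists i, phi (N + i%:Z) != 0.
  exists (absz (m - N)); have -> : N + (absz (m - N))%:Z = m; last by [].
  have [ltmN|] := ltP m N; last by lia.
  by rewrite phiN ?eqxx in phim.
case: (ex_minnP ex) => i phi_i min_i.
apply: (@le_trans _ _ (N + i%:Z)%:~R).
  apply: phir; split=> // n ltn; have [/phiN//|leNn] := ltP n N.
  apply/eqP; apply: contraTT ltn => phin; rewrite -leNgt.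
  have := min_i (absz (n - N)); have -> : N + (absz (n - N))%:Z = n by lia.
  by move=> /(_ phin); lia.
rewrite ler_int leNgt; apply/negP => ltm.
have [ltmN|leNm] := ltP m N; first by rewrite phiN ?eqxx in phim.
have := min_i (absz (m - N)); have -> : N + (absz (m - N))%:Z = m by lia.
by move=> /(_ phim); lia.
Qed.

Lemma tensor_val_ge (r : K) (U : {vspace g}) F m : tensor (val_ge r) U F ->
  F m \in U /\ (~ r <= m%:~R -> F m = 0).
Proof.
move=> [n [phi [x [phix ->]]]]; split=> [|nr].
  by apply: memv_suml => i _; rewrite memvZ// (phix i).2.
rewrite big1// => i _; suff -> : phi i m = 0 by rewrite scale0r.
by apply: contrapT => /eqP/(val_ge_coef (phix i).1).
Qed.

Lemma tensor_build (r : K) (U : {vspace g}) F : laurent F -> (forall m, F m \in U) ->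
  (forall m, F m != 0 -> r <= m%:~R) -> tensor (val_ge r) U F.
Proof.
move=> [N FN] FU Fr; exists (\dim U), (fun i m => coord (vbasis U) i (F m)).
exists (fun i => (vbasis U)`_i); split=> [i|]; last first.
  by apply/funext => m; rewrite [LHS](coord_vbasis (FU m)).
split; last by apply: vbasis_mem; rewrite mem_nth ?size_tuple.
split=> [|n [Fn _]].
  by exists N => m /FN ->; rewrite linear0.
by apply: Fr; apply: contraNneq Fn => ->; rewrite linear0.
Qed.

End Tensor.

(** * The grading by levels *)
Section Grading.
Variables (K : numFieldType) (g : vectType K) (br : {bilinear g -> g -> g}).
Hypothesis br_lie : lie_bracket br.
Variable H : {vspace g}.
Hypothesis H_cartan : cartan_subalgebra br H.
Variables (l : nat) (Gamma : l.-tuple (dual H)).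
Hypothesis Gamma_simple : simple_roots br Gamma.
Variable k : 'I_l -> nat.
Hypothesis k_max : maximal_root br Gamma (\sum_(i < l) Gamma`_i *+ k i).
Variables (j : 'I_l) (hj : subvs_of H).
Hypothesis hj_def : scaled_coweight br Gamma k j hj.
Hypothesis kj_gt0 : (0 < k j)%N.
Implicit Types (beta gamma : dual H) (x y z : g) (A B : int -> bool).

Local Notation kf := (killing br).
Local Notation lv := (level Gamma j).
Local Notation T := (vsval hj).

Definition level_roots A : set (dual H) := [set beta | roots br beta /\ A (lv beta)].

Definition level_space A : {vspace g} := root_space_sum br (level_roots A).

Lemma level_roots_sub A : level_roots A `<=` roots br (H := H).
Proof. by move=> beta []. Qed.

Lemma level_spaceS A B : (forall beta, roots br beta -> A (lv beta) -> B (lv beta)) ->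
  (level_space A <= level_space B)%VS.
Proof.
move=> AB; apply: root_space_sumS; first exact: level_roots_sub.
by move=> beta [bR bA]; split=> //; apply: AB.
Qed.

Lemma root_level_space A beta : roots br beta -> A (lv beta) ->
  (root_space br beta <= level_space A)%VS.
Proof. by move=> bR bA; apply: root_space_sub_sum => //; apply: level_roots_sub. Qed.

Lemma level_space_ind A (Pr : g -> Prop) :
  Pr 0 -> (forall x y, Pr x -> Pr y -> Pr (x + y)) ->
  (forall beta x, roots br beta -> A (lv beta) -> x \in root_space br beta -> Pr x) ->
  forall x, x \in level_space A -> Pr x.
Proof.
move=> P0 PD PA; apply: root_space_sum_ind => //; first exact: level_roots_sub.
by move=> beta x [bR bA]; apply: PA bR bA.
Qed.

Lemma parabolicE : parabolic br Gamma j = (H + level_space (fun m => m <= 0)%R)%VS.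
Proof.
apply/eqP; rewrite eqEsubv /parabolic -addvA; apply/andP; split; apply: addvS => //.
  rewrite subv_add; apply/andP; split; (apply: root_space_sumS; first exact: level_roots_sub).
    move=> beta [bR bn]; split; [exact: bR|exact: (npos_level Gamma_simple)].
  move=> beta [[bR bn] bj]; split=> //.
  have [//|b0] := leP (lv beta) 0; case: bj.
  by apply/(containing_level Gamma_simple _ bR); rewrite gt_eqF.
apply/subvP; apply: level_space_ind => [|x y|beta x bR b0 xb]; rewrite ?mem0v//.
  exact: memvD.
have negR : negative_roots br Gamma `<=` roots br (H := H) by move=> ? [].
have posR : positive_roots br Gamma `\` containing Gamma j `<=` roots br (H := H).
  by move=> ? [[]].
case: (Gamma_simple) => _ _ /(_ _ bR)[bp|bn]; last first.
  by apply: (subvP (addvSl _ _)); apply: (subvP (root_space_sub_sum negR _)) xb.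
apply: (subvP (addvSr _ _)); apply: (subvP (root_space_sub_sum posR _)) xb.
split=> // /(containing_level Gamma_simple j bR).
by have := nneg_level Gamma_simple j bR bp; lia.
Qed.

Lemma reductiveE : reductive_part br Gamma j = (H + level_space (fun m => m == 0)%R)%VS.
Proof.
congr (_ + _)%VS; apply/eqP; rewrite eqEsubv; apply/andP.
suff -> : roots br (H := H) `\` containing Gamma j = level_roots (fun m => m == 0)%R.
  by rewrite !subvv.
rewrite eqEsubset; split=> beta [bR bc]; split=> //.
  by apply: contraT => b0; case: bc; apply/(containing_level Gamma_simple j bR).
by move/(containing_level Gamma_simple j bR); rewrite (eqP bc).
Qed.

Lemma nilpotentE : nilpotent_part br Gamma j = level_space (fun m => m < 0)%R.
Proof.
congr (root_space_sum _ _); rewrite eqEsubset; split=> beta.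
  move=> [[bR bn] /(containing_level Gamma_simple j bR) b0]; split=> //.
  by have := npos_level Gamma_simple j bR bn; lia.
move=> [bR b0]; split; last by apply/(containing_level Gamma_simple j bR); lia.
split=> //; case: (Gamma_simple) => _ _ /(_ _ bR)[bp|//].
by have := nneg_level Gamma_simple j bR bp; lia.
Qed.

Lemma root_space_level beta x : roots br beta -> x \in root_space br beta ->
  br T x = ((lv beta)%:~R / (k j)%:R) *: x.
Proof. by move=> bR /mem_root_space ->; rewrite (level_val Gamma_simple hj_def). Qed.

Lemma kj_neq0 : (k j)%:R != 0 :> K.
Proof. by rewrite pnatr_eq0 -lt0n. Qed.

(** Levels are eigenvalues of the skew operator [ad hj], up to the factor
    [k j]. *)
Lemma killing_level A B x y : (forall a b, A a -> B b -> a + b != 0) ->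
  x \in level_space A -> y \in level_space B -> kf x y = 0.
Proof.
move=> AB xA; move: y; apply: level_space_ind => [|y y' xy xy'|gamma y gR gB yg].
- exact: killing0r.
- by rewrite killingDr xy xy' addr0.
move: x xA; apply: level_space_ind => [|x x' xy xy'|beta x bR bA xb].
- exact: killing0l.
- by rewrite killingDl xy xy' addr0.
apply: (killing_eigen br_lie (root_space_level bR xb) (root_space_level gR yg)).
by rewrite -mulrDl -rmorphD mulf_neq0 ?invr_eq0 ?kj_neq0// intr_eq0 AB.
Qed.

(** [H] is not known to be abelian, but [ad hj] is nilpotent on it. *)
Lemma killing_cartan_level B x y : (forall b, B b -> b != 0) ->
  x \in H -> y \in level_space B -> kf x y = 0.
Proof.
move=> B0 xH; move: y; apply: level_space_ind => [|y y' xy xy'|gamma y gR gB yg].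
- exact: killing0r.
- by rewrite killingDr xy xy' addr0.
have [n nilH] := cartan_nilpotent H_cartan.
apply: (killing_nilp_eigen br_lie (nilH _ _ (subvsP hj) xH) (root_space_level gR yg)).
by rewrite mulf_neq0 ?invr_eq0 ?kj_neq0// intr_eq0 B0.
Qed.

Lemma killing_cartan_level_add A B x y :
  (forall a b, A a -> B b -> a + b != 0) -> (forall b, B b -> b != 0) ->
  x \in (H + level_space A)%VS -> y \in level_space B -> kf x y = 0.
Proof.
move=> AB B0 /memv_addP[u uH [v vA ->]] yB.
by rewrite killingDl (killing_cartan_level B0 uH yB) (killing_level AB vA yB) addr0.
Qed.

Definition order_space (n : int) : {vspace g} :=
  ((if (n <= 0)%R then H else 0) + level_space (fun m => m <= - n * (k j)%:Z)%R)%VS.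

Lemma level_le beta (n : int) : roots br beta ->
  ((beta hj : K) <= n%:~R) = (lv beta <= n * (k j)%:Z).
Proof.
move=> bR; rewrite (level_val Gamma_simple hj_def)//.
by rewrite ler_pdivrMr ?ltr0n// -[(k j)%:R]/((k j)%:Z%:~R) -intrM ler_int.
Qed.

Lemma order_coef f n : order_polynomials br hj f -> f n \in order_space n.
Proof.
move=> [fL [f0 [fr [f0P f0H frT fE]]]].
have -> : f n = f0 (- n) + \sum_(beta \in roots br (H := H)) fr beta (- n).
  by have := congr1 (fun F => F (- n)) fE; rewrite /= opprK.
apply: memv_add.
  by case: leP => n0; [exact: f0H|rewrite f0P ?mem0v//; lia].
rewrite (fsbigE (root_seq br H)) ?root_seq_uniq//; last first.
- by move=> beta bR /negP; rewrite mem_root_seq.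
- by move=> beta /mem_root_seq.
apply: memv_suml => beta /set_mem bR; have [fb f0b] := tensor_val_ge (- n) (frT _ bR).
have [bn|bn] := pselect (beta hj <= (- n)%:~R :> K).
  by apply: (subvP (root_level_space bR _)) fb; rewrite level_le in bn.
by rewrite f0b// mem0v.
Qed.

Lemma order_build f (b : nat) : laurent f -> (forall n, b%:Z < n -> f n = 0) ->
  (forall n, f n \in order_space n) -> order_polynomials br hj f.
Proof.
move=> fL fb fO; split=> //.
have dec n : exists p : g * (dual H -> g),
    [/\ p.1 \in (if n <= 0 then H else 0%VS) /\
        f n = p.1 + \sum_(beta <- root_seq br H) p.2 beta,
        forall beta, roots br beta -> p.2 beta \in root_space br beta,
        forall beta, roots br beta -> p.2 beta != 0 -> lv beta <= - n * (k j)%:Z &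
        b%:Z < n -> p.2 = fun=> 0].
  have [bn|nb] := ltP b%:Z n.
    exists (0, fun=> 0); split=> //=.
    - by rewrite mem0v fb// big1// addr0.
    - by move=> ? ?; rewrite mem0v.
    - by move=> ? ?; rewrite eqxx.
  have /memv_addP[u uH [v vL fE]] := fO n.
  have [F [FA F0 vE]] := (root_space_sumP v (@level_roots_sub _)).1 vL.
  exists (u, F); split=> //=.
  - by rewrite fE vE.
  - move=> beta bR; have [bl|bl] := boolP (lv beta <= - n * (k j)%:Z); first exact: FA.
    by rewrite F0 ?mem0v// => -[_]; apply/negP.
  - move=> beta bR; apply: contraNT => bl; apply/eqP/F0 => -[_]; exact/negP.
have [p pP] := choice dec.
exists (fun m => (p (- m)).1), (fun beta m => (p (- m)).2 beta); split.
- move=> m m0; have [[+ _] _ _ _] := pP (- m).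
  by rewrite ifN ?memv0 => [/eqP //|]; lia.
- move=> m; have [[+ _] _ _ _] := pP (- m).
  by case: ifP => // _; rewrite memv0 => /eqP ->; apply: mem0v.
- move=> beta bR; apply: tensor_build.
  + exists (- b%:Z) => m mb; have [_ _ _ ->//] := pP (- m); by lia.
  + by move=> m; have [_ + _ _] := pP (- m); apply.
  + move=> m; have [_ _ + _] := pP (- m) => /(_ _ bR) H1 /H1.
    by rewrite level_le// opprK.
- apply/funext => m; have [[_ ->] _ _ _] := pP (- m); congr (_ + _).
  rewrite (fsbigE (root_seq br H)) ?root_seq_uniq//.
  + rewrite [RHS]big_mkcond; apply: eq_big_seq => beta /mem_root_seq bR.
    by rewrite mem_set.
  + by move=> beta /mem_root_seq.
  + by move=> beta bR /negP; rewrite mem_root_seq.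
Qed.

Local Notation S := (H + level_space xpredT)%VS.
Local Notation P := (H + level_space (fun m => m <= 0)%R)%VS.
Local Notation N := (level_space (fun m => m < 0)%R).
Local Notation M := (H + level_space (fun m => m == 0)%R)%VS.

Lemma order_space_sub n : (order_space n <= S)%VS.
Proof.
apply: addvS; last exact: level_spaceS.
by case: ifP => _; rewrite ?sub0v.
Qed.

(** Every [u^-1 x] is the sum of an element of [W] and a power series, so [x] is a
    coefficient of an element of the order. *)
Lemma loop_decomposition (W : set ((int -> g) * g)) :
  transversal_subspaces (loop_double g) W (current_algebra g) ->
  (forall p, W p -> order_polynomials br hj p.1) -> forall x, x \in S.
Proof.
move=> [Wsum _] WO x.
have : loop_double g (single (-1) x, 0) by apply: single_laurent.
rewrite Wsum => -[w Ww [_ [d dP ->]]] => /(congr1 (fun p => p.1 (-1))).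
rewrite /= /single eqxx !fctE dP// addr0 => <-.
exact: (subvP (order_space_sub (-1))) (order_coef (-1) (WO _ Ww)).
Qed.

Lemma level_space_split A B C : (forall m, A m -> B m || C m) ->
  (level_space A <= level_space B + level_space C)%VS.
Proof.
move=> ABC; apply/subvP; apply: level_space_ind => [|x y|beta x bR /ABC/orP[] bB xb].
- exact: mem0v.
- exact: memvD.
- by apply: (subvP (addvSl _ _)); apply: (subvP (root_level_space bR bB)).
- by apply: (subvP (addvSr _ _)); apply: (subvP (root_level_space bR bB)).
Qed.

Lemma parabolic_split : P = (M + N)%VS.
Proof.
apply/eqP; rewrite eqEsubv -addvA; apply/andP; split; apply: addvS => //.
  by apply: level_space_split => m; rewrite le_eqVlt.
rewrite subv_add; apply/andP; split; apply: level_spaceS => beta _; first by move/eqP->.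
exact: ltW.
Qed.

Lemma level_nilpotent_le : (N <= P)%VS.
Proof. by rewrite parabolic_split addvSr. Qed.

Definition level_eigenvalues A : seq K :=
  [seq (lv beta)%:~R / (k j)%:R | beta <- root_seq br H & A (lv beta)].

Lemma level_eigenvalues_kill A x : x \in level_space A ->
  ad_prod br (poly_ad T (level_eigenvalues A)) x = 0.
Proof.
move: x; apply: level_space_ind => [|x y xA yA|beta x bR bA xb].
- exact: ad_prod0.
- by rewrite ad_prodD xA yA addr0.
rewrite (poly_ad_eigen _ (root_space_level bR xb)).
apply/eqP; rewrite scaler_eq0 prodf_seq_eq0; apply/orP; left; apply/hasP.
exists ((lv beta)%:~R / (k j)%:R); last by rewrite subrr/=.
by apply/mapP; exists beta => //; rewrite mem_filter bA; apply/mem_root_seq.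
Qed.

(** The factors come from the nilpotency of [H], except for one that kills the
    root spaces of level 0. *)
Lemma reductive_nilpotent : exists n, forall x, x \in M ->
  ad_prod br (poly_ad T (nseq n.+1 0)) x = 0.
Proof.
have [n nilH] := cartan_nilpotent H_cartan; exists n.
move=> _ /memv_addP[x xH [y yM ->]]; rewrite ad_prodD [ad_prod _ _ x]/=.
rewrite nilH ?subvsP// linear0r scaler0 subr0 add0r.
move: y yM; apply: level_space_ind => [|u v u0 v0|beta u bR /eqP b0 ub].
- exact: ad_prod0.
- by rewrite ad_prodD u0 v0 addr0.
rewrite (poly_ad_eigen _ (root_space_level bR ub)) b0 mul0r.
by rewrite big_cons subrr mul0r scale0r.
Qed.

Lemma reductive_nilpotent_cap : (M :&: N = 0)%VS.
Proof.
apply/eqP; rewrite -subv0; apply/subvP => x; rewrite memv_cap => /andP[xM xN].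
have [n nilM] := reductive_nilpotent; rewrite memv0; apply/eqP.
apply: poly_ad_coprime (nilM _ xM) (level_eigenvalues_kill xN).
move=> c d; rewrite mem_nseq => /andP[_ /eqP ->] /mapP[beta].
rewrite mem_filter => /andP[b0 _] ->; rewrite eq_sym mulf_neq0 ?invr_eq0 ?kj_neq0//.
by rewrite intr_eq0 lt_eqF.
Qed.

(** Since the reductive part and the nilradical are in direct sum, the projection
    to the former has the latter as kernel on [P]. *)
Lemma DeltaE : Delta br Gamma j = same_reductive P N.
Proof.
have capNM : (N :&: M = 0)%VS by rewrite capvC reductive_nilpotent_cap.
rewrite eqEsubset /Delta /same_reductive parabolicE reductiveE nilpotentE.
have split1 x : x \in P -> daddv_pi M N x + daddv_pi N M x = x.
  by move=> xP; apply: daddv_pi_add; rewrite ?reductive_nilpotent_cap -?parabolic_split.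
split=> p [p1 p2 p12]; split=> //.
  rewrite -(split1 _ p1) -(split1 _ p2) p12 opprD addrACA subrr add0r.
  by rewrite memvB ?memv_pi.
apply/eqP; rewrite -subr_eq0 -linearB/=.
have := split1 _ (memvB p1 p2); rewrite (daddv_pi_id capNM p12).
by move/(canRL (addrK _)); rewrite subrr => ->.
Qed.

Lemma killing_parabolic x y : x \in P -> y \in N -> kf x y = 0.
Proof. by apply: killing_cartan_level_add => [a b|b]; lia. Qed.

Lemma same_reductive_isotropic p q : same_reductive P N p -> same_reductive P N q ->
  double_form br p q = 0.
Proof.
move=> [p1 p2 pN] [q1 q2 qN]; rewrite /double_form.
move: pN qN; set a := p.1 - p.2; set b := q.1 - q.2 => aN bN.
have -> : p.1 = a + p.2 by rewrite subrK.
have -> : q.1 = b + q.2 by rewrite subrK.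
clearbody a b; rewrite killingDl !killingDr (killing_parabolic p2 bN).
rewrite [kf a q.2]killingC (killing_parabolic q2 aN).
rewrite (killing_parabolic (subvP level_nilpotent_le _ aN) bN).
by rewrite !add0r subrr.
Qed.

Lemma cartan_stable A (h : subvs_of H) x :
  x \in level_space A -> br (vsval h) x \in level_space A.
Proof.
move: x; apply: level_space_ind => [|x y|beta x bR bA xb].
- by rewrite linear0r mem0v.
- by rewrite linearDr; apply: memvD.
- by apply: (subvP (root_level_space bR bA)); rewrite ((mem_root_space _ _ _).1 xb) memvZ.
Qed.

Lemma cartan_stable_add A (h : subvs_of H) x :
  x \in (H + level_space A)%VS -> br (vsval h) x \in (H + level_space A)%VS.
Proof.
move=> /memv_addP[u uH [v vA ->]]; rewrite linearDr memv_add ?cartan_stable//.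
by apply: (cartan_br H_cartan); rewrite ?subvsP.
Qed.

(** * Root decomposition from a Lagrangian complement of Delta *)
Section DoubleDecomposition.
Hypothesis nondeg : killing_nondeg br.
Variable L : set (g * g).
Hypothesis L_lagrangian : lagrangian setT (double_bracket br) (double_form br) L.
Hypothesis L_transversal : transversal_subspaces setT L (same_reductive P N).

(** Write [(x, 0) = w + d] with [w] in [L] and [d] in [Delta].  Both [(x, 0)] and
    [Delta] are orthogonal to [Delta], and [L] to [L], so [w] is orthogonal to
    everything; hence [(x, 0)] is in [Delta]. *)
Lemma parabolic_perp x : (forall y, y \in P -> kf x y = 0) -> x \in N.
Proof.
move=> xP; have [Lsum _] := L_transversal; have [_ LE] := L_lagrangian.
have : [set: g * g] (x, 0) by [].
rewrite Lsum => -[w Lw [d Dd wd]].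
have w1 : w.1 = x - d.1 by case: wd => <- _; rewrite addrK.
have w2 : w.2 = - d.2 by case: wd => _ /eqP; rewrite addr_eq0 => /eqP.
have Qw q : double_form br w q = 0.
  have : [set: g * g] q by [].
  rewrite Lsum => -[w' Lw' [d' Dd' <-]].
  have : double_form br w w' = 0 by move: Lw; rewrite {1}LE => -[_]; apply.
  have : double_form br w d' = 0.
    rewrite /double_form w1 w2 killingBl killingNl xP; last by case: Dd'.
    by rewrite sub0r -opprD -/(double_form br d d') -mulN1r same_reductive_isotropic// mulr0.
  rewrite /double_form /= !killingDr => dw' dw.
  by rewrite opprD addrACA dw dw' addr0.
have w10 : w.1 = 0.
  by apply: nondeg => y; have := Qw (y, 0); rewrite /double_form killing0r subr0.
have w20 : w.2 = 0.
  apply: nondeg => y; have := Qw (0, y); rewrite /double_form killing0r sub0r.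
  by move/eqP; rewrite oppr_eq0 => /eqP.
case: Dd => _ _; move: w1 w2; rewrite w10 w20 => /esym/eqP; rewrite subr_eq0 => /eqP <-.
by move=> /esym/eqP; rewrite oppr_eq0 => /eqP ->; rewrite subr0.
Qed.

Lemma perp_nilpotent x : (forall y, y \in N -> kf y x = 0) -> x \in P.
Proof.
move=> xN; apply: (killing_biorthogonal nondeg) => y yP.
by apply: xN; apply: parabolic_perp.
Qed.

(** Pairing with [z] is a functional of weight [- beta], and the task is to find a
    genuine vector of that weight on which it does not vanish.  Modulo [P], which
    is the orthogonal of the nilradical, projecting [x] makes it a weight vector.
    As [ad hj] has no positive eigenvalue on [P] while [- beta hj] is positive, a
    polynomial in [ad hj] that kills [P] then removes the error term, up to a defect in [P]
    that is both killed by that polynomial and generalized of eigenvalue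
    [- beta hj], hence zero. *)
Lemma dual_root_vector beta x z : roots br beta -> lv beta < 0 ->
  z \in root_space br beta -> kf x z != 0 ->
  exists2 y, (forall h : subvs_of H, br (vsval h) y = - (beta h : K) *: y) & kf y z != 0.
Proof.
move=> bR b0 zb xz.
have [a a0 aE] := projector_fix_dual br_lie beta (root_seq br H).
pose x1 := ad_prod br (projector (-1) beta (root_seq br H)) x.
have x1P h : br (vsval h) x1 + (beta h : K) *: x1 \in P.
  apply: perp_nilpotent; apply: level_space_ind => [|u v ux vx|gamma y gR _ yg].
  - exact: killing0l.
  - by rewrite killingDl ux vx addr0.
  rewrite killingC killingDl killing_ad// killingZl ((mem_root_space _ _ _).1 yg).
  rewrite killingZr; have [->|gb] := eqVneq gamma beta; first by rewrite addNr.
  rewrite (projector_kill_dual br_lie _ _ gb yg); last exact/mem_root_seq.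
  by rewrite !mulr0 oppr0 addr0.
(* [cs] annihilates [P] under [ad hj] *)
have [n nilM] := reductive_nilpotent.
pose cs := nseq n.+1 0 ++ level_eigenvalues (fun m => m < 0).
pose c : K := - (beta hj : K).
have csP u : u \in P -> ad_prod br (poly_ad T cs) u = 0.
  rewrite parabolic_split => /memv_addP[v vM [w wN ->]].
  rewrite ad_prodD !poly_ad_cat (level_eigenvalues_kill wN) ad_prod0 addr0.
  by rewrite poly_ad_comm (nilM _ vM) ad_prod0.
have csneg d : d \in cs -> exists2 m : int, m <= 0 & d = m%:~R / (k j)%:R.
  rewrite mem_cat => /orP[|/mapP[gamma]].
    by rewrite mem_nseq => /andP[_ /eqP ->]; exists 0; rewrite ?mul0r.
  by rewrite mem_filter => /andP[/ltW g0 _] ->; exists (lv gamma).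
have betaE : (beta hj : K) = (lv beta)%:~R / (k j)%:R by apply: level_val bR.
have cs_neq d : d \in cs -> c != d.
  move=> /csneg[m m0 ->]; rewrite /c betaE -mulNr -mulrNz.
  rewrite (inj_eq (mulIf _)) ?invr_eq0 ?kj_neq0// eqr_int; lia.
pose x2 := ad_prod br (poly_ad T cs) x1.
have Tx2 : br T x2 = c *: x2.
  rewrite -poly_ad_comm1 /x2 -ad_prodZ.
  have -> : br T x1 = (br T x1 + (beta hj : K) *: x1) + c *: x1.
    by rewrite -addrA -scalerDl subrr scale0r addr0.
  by rewrite ad_prodD csP ?add0r.
have x2z : kf x2 z != 0.
  have -> : kf x2 z = (\prod_(p <- poly_ad T cs) - ((beta hj : K) + p.2)) * kf x1 z.
    by apply: (@killing_ad_prod _ _ _ br_lie _ (fun=> beta hj)) => _ /mapP[d _ ->];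
       exact: ((mem_root_space br beta z).1 zb hj).
  rewrite aE// !mulf_neq0// big_map prodf_seq_neq0; apply/allP => d /cs_neq.
  by rewrite /= opprD subr_eq0.
(* [x2] is still a weight vector modulo [P] *)
have x2P h : br (vsval h) x2 + (beta h : K) *: x2 \in P.
  move: h; rewrite /x2; apply: (ad_prod_ind (Pr := fun y => forall h,
    br (vsval h) y + (beta h : K) *: y \in P)) => // _ /mapP[d _ ->] y yP h /=.
  have -> : br T y - d *: y = (br T y + (beta hj : K) *: y) - ((beta hj : K) + d) *: y.
    by rewrite scalerDl opprD addrA addrK.
  have := cartan_stable_add h (yP hj); move: (yP hj).
  set p := br T y + _; set a' := _ + d => pP hpP.
  rewrite linearBr linearZr_LR scalerBr addrACA -opprD.
  rewrite [_ *: (_ *: y)]scalerA [(beta h : K) * _]mulrC -scalerA -scalerDr.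
  by apply: memvB; [apply: memvD => //; apply: memvZ|apply: memvZ].
exists x2 => // h; apply/eqP; rewrite scaleNr -addr_eq0; apply/eqP.
(* the defect is [[h, x2]] up to an eigenvector, and [ad hj] is nilpotent at [h] *)
have w0 : ad_prod br (poly_ad T (nseq n.+1 c)) (br (vsval h) x2 + (beta h : K) *: x2) = 0.
  rewrite ad_prodD ad_prodZ (poly_ad_br br_lie _ _ Tx2) (poly_ad_eigen _ Tx2).
  rewrite nilM ?linear0l; last by apply: (subvP (addvSl _ _)); apply: subvsP.
  by rewrite big_cons subrr mul0r scale0r scaler0 addr0.
apply: poly_ad_coprime (csP _ (x2P h)) w0 => d e dcs.
by rewrite mem_nseq => /andP[_ /eqP ->]; rewrite eq_sym; apply: cs_neq.
Qed.

(** Otherwise some [z] is orthogonal to the span of [H] and the root spaces.  It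
    lies in the nilradical and may be taken in one root space [beta]; then
    [dual_root_vector] yields a root vector of weight [- beta] that is not
    orthogonal to it. *)
Lemma double_decomposition x : x \in S.
Proof.
apply: (killing_biorthogonal nondeg) => z zS.
suff -> : z = 0 by rewrite killing0l.
have PS : (P <= S)%VS by apply: addvS => //; apply: level_spaceS.
have zN : z \in N by apply: parabolic_perp => y yP; apply/zS/(subvP PS).
have [F [FN F0 zE]] := (root_space_sumP z (@level_roots_sub _)).1 zN.
apply/eqP/negPn/negP => z0.
have [beta bR Fb] : exists2 beta, beta \in root_seq br H & F beta != 0.
  apply/hasP; apply: contraNT z0 => /hasPn F00; rewrite zE big_seq big1// => beta.
  by move=> /F00; rewrite negbK => /eqP.
have [bR' b0] : level_roots (fun m => m < 0) beta.
  by apply: contrapT => /F0 /eqP; rewrite (negPf Fb).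
have [a a0 aE] := projector_fix br beta (root_seq br H).
pose z' := ad_prod br (projector 1 beta (root_seq br H)) z.
have z'E : z' = a *: F beta.
  rewrite /z' zE ad_prod_sum (bigD1_seq beta) ?root_seq_uniq//= big1_seq ?addr0 ?aE//.
    exact: FN.
  move=> gamma /andP[gb gR]; have [gN|/F0 ->] := pselect (level_roots (fun m => m < 0) gamma).
    by apply: projector_kill gR gb _; apply: FN.
  exact: ad_prod0.
have z'S u : u \in S -> kf z' u = 0.
  move: u; apply: (ad_prod_ind (Pr := fun y => forall u, u \in S -> kf y u = 0)) => //.
  move=> _ /mapP[gamma _ ->] y yS u uS /=.
  by rewrite killingBl killing_ad// killingZl (yS _ uS)
     (yS _ (cartan_stable_add _ uS)) mulr0 oppr0 addr0.
have z'b : z' \in root_space br beta by rewrite z'E memvZ// FN.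
have [y zy] : exists y, kf y z' != 0.
  apply: contrapT => /forallNP yz'; have : z' = 0.
    by apply: nondeg => y; rewrite killingC; apply/eqP/negPn/negP/yz'.
  by rewrite z'E => /eqP; rewrite scaler_eq0 (negPf a0) (negPf Fb).
have [w wb wz] := dual_root_vector bR' b0 z'b zy.
have wR : w \in root_space br (- beta).
  by apply/mem_root_space => h; rewrite wb opp_lfunE.
case/eqP: (wz); rewrite killingC; apply: z'S; apply: (subvP (addvSr _ _)).
apply: (subvP (root_level_space _ _)) (wR) => //; split; first by rewrite oppr_eq0; case: bR'.
apply: contraNneq wz => wR0; move: wR; rewrite wR0 memv0 => /eqP ->.
by rewrite killing0l.
Qed.

End DoubleDecomposition.

(** * Consequences of the root decomposition *)
Section Decomposed.
Hypothesis nondeg : killing_nondeg br.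
Hypothesis decomposed : forall x, x \in S.

Lemma level_perp0 x : (forall y, y \in H -> kf x y = 0) ->
  (forall beta y, roots br beta -> y \in root_space br beta -> kf x y = 0) -> x = 0.
Proof.
move=> xH xR; apply: nondeg => y; have /memv_addP[u uH [v vS ->]] := decomposed y.
rewrite killingDr xH// add0r; move: v vS.
apply: level_space_ind => [|v w xv xw|beta v bR _ vb]; first exact: killing0r.
  by rewrite killingDr xv xw addr0.
exact: xR bR vb.
Qed.

Lemma level_eq0 A x : x \in level_space A ->
  (forall beta m, roots br beta -> A m -> m + lv beta != 0) ->
  (forall m, A m -> m != 0) -> x = 0.
Proof.
move=> xA AR A0; apply: level_perp0 => [y yH|beta y bR yb].
  by rewrite killingC; apply: killing_cartan_level yH xA.
apply: (killing_level (B := fun m => m == lv beta)) xA _ => [m _ Am /eqP ->|].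
  exact: AR.
exact: (subvP (root_level_space bR _)) yb.
Qed.

Lemma root_vector_neq0 beta : roots br beta ->
  exists2 x, x \in root_space br beta & x != 0.
Proof.
by case=> _ b0; exists (vpick (root_space br beta)); rewrite ?memv_pick ?vpick0.
Qed.

(** With [y] of level -1, the element [(1 - u) y] is orthogonal to the order: it
    pairs with the constant coefficient, and level 1 only starts at [u^-1].  So
    it lies in [W], but the order does not allow [y] as a coefficient of [u],
    because its level exceeds [- k j]. *)
Lemma no_loop_lagrangian (W : set ((int -> g) * g)) : (1 < k j)%N ->
  lagrangian (loop_double g) (loop_double_bracket br)
    (loop_double_form br (geometric K)) W ->
  (forall p, W p -> order_polynomials br hj p.1) -> False.
Proof.
move=> k1 [_ WE] WO; have [aR a1] := simple_level Gamma_simple j.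
have [gamma gR g1] : exists2 gamma, roots br gamma & lv gamma = -1.
  apply: contrapT => ng; have [x xa /eqP[]] := root_vector_neq0 aR.
  have xA : x \in level_space (pred1 1).
    by apply: (subvP (root_level_space aR _)) xa; rewrite /= a1.
  apply: (level_eq0 xA) => [beta m bR /eqP ->|m /eqP ->//].
  by apply/eqP => b1; apply: ng; exists beta => //; lia.
have [y yg /eqP[]] := root_vector_neq0 gR.
have yL : y \in level_space (pred1 (-1)).
  by apply: (subvP (root_level_space gR _)) yg; rewrite /= g1.
have fL : laurent (single 0 y - single (0 + 1) y).
  by apply: laurentB; apply: single_laurent.
have /WO/(order_coef 1)/= : W (single 0 y - single (0 + 1) y, 0).
  rewrite WE; split=> // w Ww; rewrite loop_double_formC.
  case: w Ww => f x Ww; rewrite loop_double_form_step//; last first.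
    by move: Ww; rewrite WE => -[].
  rewrite oppr0; have := order_coef 0 (WO _ Ww); rewrite /order_space /= oppr0 mul0r => f0.
  by apply: killing_cartan_level_add f0 yL => [a b|b]; rewrite /=; lia.
rewrite /order_space /= add0v !fctE /single /= sub0r memvN => yK.
apply: level_perp0 => [z zH|beta z bR zb].
  by rewrite killingC; apply: killing_cartan_level zH yL => b /eqP ->.
have zB : z \in level_space (pred1 (lv beta)).
  by apply: (subvP (root_level_space bR _)) zb; rewrite /=.
have [b1|b1] := eqVneq (lv beta) 1.
  by apply: killing_level yK zB => a b /=; rewrite b1; lia.
by apply: killing_level yL zB => a b /= /eqP -> /eqP ->; lia.
Qed.

Hypothesis k1 : k j = 1%N.

Lemma level_le1 beta : roots br beta -> lv beta <= 1.
Proof. by move=> bR; have := level_max Gamma_simple k_max j bR; rewrite k1. Qed.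

(** Root vectors of a lower level would be orthogonal to everything, as there is
    no root of the opposite level. *)
Lemma level_geN1 beta : roots br beta -> -1 <= lv beta.
Proof.
move=> bR; rewrite leNgt; apply/negP => b1; have [x xb /eqP[]] := root_vector_neq0 bR.
have xB : x \in level_space (pred1 (lv beta)).
  by apply: (subvP (root_level_space bR _)) xb; rewrite /=.
apply: (level_eq0 xB) => [gamma m gR /eqP ->|m /eqP ->]; last by lia.
by have := level_le1 gR; lia.
Qed.

Lemma nilpotent_perp x : (forall y, y \in N -> kf x y = 0) -> x \in P.
Proof.
move=> xN; have : x \in (P + level_space (fun m => (0 < m)%R))%VS.
  have := decomposed x; apply/subvP; rewrite -addvA addvS//.
  by apply: level_space_split => m _; lia.
move=> /memv_addP[p pP [q qL xE]]; suff -> : x = p by [].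
rewrite xE (_ : q = 0) ?addr0//.
apply: level_perp0 => [z zH|beta z bR zb].
  by rewrite killingC; apply: killing_cartan_level zH qL; lia.
have zB : z \in level_space (pred1 (lv beta)).
  by apply: (subvP (root_level_space bR _)) zb; rewrite /=.
have [b0|b0] := ltP (lv beta) 0; last first.
  by apply: killing_level qL zB => a b /= ? /eqP ->; lia.
have zN : z \in N by apply: (subvP (root_level_space bR _)) zb.
have := xN _ zN; rewrite xE killingDl killing_parabolic// add0r.
by [].
Qed.

(** A bracket has level -2, which pairs with no level. *)
Lemma nilpotent_abelian x y : x \in N -> y \in N -> br x y = 0.
Proof.
move=> xN yN; move: x xN; apply: level_space_ind => [|u v uy vy|beta x bR b0 xb].
- exact: linear0l.
- by rewrite linearDl uy vy addr0.
move: y yN; apply: level_space_ind => [|u v uy vy|gamma y gR g0 yg].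
- exact: linear0r.
- by rewrite linearDr uy vy addr0.
have Tz : br T (br x y) = ((lv beta + lv gamma)%:~R / (k j)%:R) *: br x y.
  rewrite jacobi// (root_space_level bR xb) (root_space_level gR yg).
  by rewrite linearZl_LR linearZr_LR -scalerDl -mulrDl -rmorphD.
have := level_geN1 bR; have := level_geN1 gR => gN1 bN1.
apply: level_perp0 => [z zH|delta z dR zd].
  have [n nilH] := cartan_nilpotent H_cartan.
  rewrite killingC; apply: (killing_nilp_eigen br_lie (nilH _ _ (subvsP hj) zH) Tz).
  by rewrite mulf_neq0 ?invr_eq0 ?kj_neq0// intr_eq0; lia.
apply: (killing_eigen br_lie Tz (root_space_level dR zd)).
rewrite -mulrDl -rmorphD mulf_neq0 ?invr_eq0 ?kj_neq0// intr_eq0.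
by have := level_le1 dR; lia.
Qed.

Lemma parabolic_br x y : x \in P -> y \in P -> br x y \in P.
Proof.
have brH (u v : g) : u \in H -> v \in P -> br u v \in P.
  by move=> uH vP; have := cartan_stable_add (vsproj H u) vP; rewrite vsprojK.
move=> /memv_addP[u uH [v vL ->]] yP; rewrite linearDl memvD//; first exact: brH.
case/memv_addP: yP => [s sH [t tL ->]]; rewrite linearDr memvD//.
  by rewrite bracketC// memvN brH// (subvP (addvSr _ _)).
move: v vL; apply: level_space_ind => [|u' v' ut vt|beta v bR b0 vb].
- by rewrite linear0l mem0v.
- by rewrite linearDl memvD.
move: t tL; apply: level_space_ind => [|u' v' ut vt|gamma t gR g0 tg].
- by rewrite linear0r mem0v.
- by rewrite linearDr memvD.
have Tz : br T (br v t) = ((lv beta + lv gamma)%:~R / (k j)%:R) *: br v t.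
  rewrite jacobi// (root_space_level bR vb) (root_space_level gR tg).
  by rewrite linearZl_LR linearZr_LR -scalerDl -mulrDl -rmorphD.
apply: nilpotent_perp; apply: level_space_ind => [|u' v' ut vt|delta z dR d0 zd].
- exact: killing0r.
- by rewrite killingDr ut vt addr0.
apply: (killing_eigen br_lie Tz (root_space_level dR zd)).
by rewrite -mulrDl -rmorphD mulf_neq0 ?invr_eq0 ?kj_neq0// intr_eq0; lia.
Qed.

Lemma order_space_filtration n : order_space n = filtration P N n.
Proof.
have full : S = fullv :> {vspace g}.
  by apply/eqP; rewrite eqEsubv subvf; apply/subvP => x _; apply: decomposed.
rewrite /order_space k1; case: filtrationP => [n0|->|->|n1].
- rewrite ltW//; apply/eqP; rewrite eqEsubv subvf/= -full addvS//.
  by apply: level_spaceS => beta /level_le1; lia.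
- by rewrite lexx oppr0 mul0r.
- rewrite /= add0v; apply/eqP; rewrite eqEsubv.
  by apply/andP; split; apply: level_spaceS => beta _; lia.
- rewrite ifN ?add0v; last by lia.
  apply/eqP; rewrite -subv0; apply/subvP; apply: level_space_ind.
  + exact: mem0v.
  + by move=> x y; apply: memvD.
  + by move=> beta x /level_geN1; lia.
Qed.

Lemma order_polynomials_filtered f : order_polynomials br hj f <-> filtered P N f.
Proof.
split=> [fO|[fL fF]].
  by split=> [|n]; [case: fO|rewrite -order_space_filtration; apply: order_coef].
apply: (@order_build _ 1) => // n; last by rewrite order_space_filtration.
by move=> n1; have := fF n; rewrite filtration_gt1// memv0 => /eqP.
Qed.

Theorem decomposed_bij :
  let lagrangian_in_loop := [set W : set ((int -> g) * g) |
    [/\ lagrangian (loop_double g) (loop_double_bracket br)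
          (loop_double_form br (geometric K)) W,
        transversal_subspaces (loop_double g) W (current_algebra g) &
        forall p, W p -> order_polynomials br hj p.1]] in
  let lagrangian_in_double := [set L : set (g * g) |
    lagrangian setT (double_bracket br) (double_form br) L /\
    transversal_subspaces setT L (Delta br Gamma j)] in
  exists Phi : set ((int -> g) * g) -> set (g * g),
     set_bij lagrangian_in_loop lagrangian_in_double Phi.
Proof.
move=> loopL doubleL; exists (fun W => @evaluate _ g @` W).
have -> : loopL = loop_lagrangians br P N.
  rewrite eqEsubset; split=> W [WL WT WO]; split=> // p /WO.
    by move/order_polynomials_filtered.
  by move=> ?; apply/order_polynomials_filtered.
have -> : doubleL = double_lagrangians br P N by rewrite /doubleL DeltaE.
apply: evaluate_bij => //.
- exact: level_nilpotent_le.
- exact: parabolic_br.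
- exact: nilpotent_abelian.
- exact: nilpotent_perp.
- exact: killing_parabolic.
Qed.

End Decomposed.

End Grading.

(** * The degenerate case and the conclusion *)
Section ZeroForm.
Variables (K : numFieldType) (g : vectType K) (br : {bilinear g -> g -> g}).
Hypothesis killing0 : forall x y, killing br x y = 0.

(** For the zero form only the whole space is Lagrangian, and it meets the
    constants. *)
Lemma zero_form_loop (W : set ((int -> g) * g)) (x : g) :
  lagrangian (loop_double g) (loop_double_bracket br)
    (loop_double_form br (geometric K)) W ->
  transversal_subspaces (loop_double g) W (current_algebra g) -> x = 0.
Proof.
move=> [_ WE] [_ Wcap]; have xL : laurent (single 0 x) by apply: single_laurent.
have : (W `&` current_algebra g) (single 0 x, x).
  split; last first.
    exists (single 0 x); first by move=> m m0; rewrite /single lt_eqF.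
    by rewrite /single eqxx.
  rewrite WE; split=> // -[f y] Wf; rewrite loop_double_formE//; last first.
    by move: Wf; rewrite WE => -[].
  by rewrite killing0 subr0 fsbig1.
by rewrite Wcap => -[].
Qed.

Lemma zero_form_double (L D : set (g * g)) (p : g * g) :
  lagrangian setT (double_bracket br) (double_form br) L ->
  transversal_subspaces setT L D -> D p -> p = 0.
Proof.
move=> [_ LE] [_ Lcap] Dp; suff : (L `&` D) p by rewrite Lcap.
by split=> //; rewrite LE; split=> // q _; rewrite /double_form !killing0 subr0.
Qed.

End ZeroForm.

Lemma set_bij_empty {aT rT : Type} (A : set aT) (B : set rT) (f : aT -> rT) :
  ~ (exists a, A a) -> ~ (exists b, B b) -> set_bij A B f.
Proof.
move=> A0 B0; split=> [a Aa|a b|b Bb]; first by case: A0; exists a.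
  by rewrite inE => Aa; case: A0; exists a.
by case: B0; exists b.
Qed.

Theorem theorem3p3 (R : realType) (g : vectType (complex R))
  (br : {bilinear g -> g -> g}) (g_simple : simple_lie_algebra br)
  (H : {vspace g}) (H_cartan : cartan_subalgebra br H)
  (l : nat) (Gamma : l.-tuple (dual H)) (Gamma_simple : simple_roots br Gamma)
  (k : 'I_l -> nat)
  (k_max : maximal_root br Gamma (\sum_(i < l) Gamma`_i *+ k i))
  (j : 'I_l) (hj : subvs_of H) (hj_def : scaled_coweight br Gamma k j hj) :
  let lagrangian_in_loop := [set W : set ((int -> g) * g) |
    [/\ lagrangian (loop_double g) (loop_double_bracket br)
          (loop_double_form br (geometric (complex R))) W,
        transversal_subspaces (loop_double g) W (current_algebra g) &
        forall p, W p -> order_polynomials br hj p.1]] in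
  let lagrangian_in_double := [set L : set (g * g) |
    lagrangian setT (double_bracket br) (double_form br) L /\
    transversal_subspaces setT L (Delta br Gamma j)] in
  (k j = 1%N -> exists Phi : set ((int -> g) * g) -> set (g * g),
     set_bij lagrangian_in_loop lagrangian_in_double Phi) /\
  ((1 < k j)%N -> ~ exists W, lagrangian_in_loop W).
Proof.
move=> loopL doubleL; have [br_lie br_neq0 _] := g_simple.
have [nondeg|killing0] := simple_killing br_lie g_simple; last first.
  have loop0 : ~ exists W, loopL W.
    case: br_neq0 => x [y /eqP xy] [W [WL WT _]]; apply: xy.
    by rewrite (zero_form_loop killing0 x WL WT) linear0l.
  have double0 : ~ exists L, doubleL L.
    move=> [L [LL LT]]; case/negP: (cartan_neq0 H_cartan br_neq0).
    rewrite -subv0; apply/subvP => h hH; rewrite memv0.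
    have hP : h \in parabolic br Gamma j by rewrite /parabolic -addvA (subvP (addvSl _ _)).
    have Dh : Delta br Gamma j (h, h) by [].
    by have [->] := zero_form_double killing0 LL LT Dh.
  by split=> // _; exists (fun=> set0); apply: set_bij_empty.
split=> [kj1|kj1 [W [WL WT WO]]]; last first.
  apply: (no_loop_lagrangian br_lie H_cartan Gamma_simple hj_def _ nondeg _ kj1 WL WO).
    exact: ltnW.
  exact: (loop_decomposition Gamma_simple hj_def (ltnW kj1) WT WO).
have kj_gt0 : (0 < k j)%N by rewrite kj1.
have [decomposed|ndec] := pselect
    (forall x, x \in (H + level_space br Gamma j xpredT)%VS).
  exact: (decomposed_bij br_lie H_cartan Gamma_simple k_max hj_def).
exists (fun=> set0); apply: set_bij_empty.
  move=> [W [WL WT WO]]; apply: ndec.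
  exact: (loop_decomposition Gamma_simple hj_def kj_gt0 WT WO).
move=> [L [LL LT]]; apply: ndec => x.
apply: (double_decomposition br_lie H_cartan Gamma_simple hj_def kj_gt0 nondeg LL).
by rewrite -(DeltaE H_cartan Gamma_simple hj_def kj_gt0).
Qed.
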